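(* Let $K$ be a number field, $b\in K$, $b\neq0$, and $\mathcal{E}_1: y^2=x^3+bx$, with $K_7=K(\mathcal{E}_1[7])$. Let $x_1=\sqrt{\omega_1b+\frac12 b\sqrt{\theta_1}}$ and $y_1=\sqrt{\left(\omega_1+\frac12\sqrt{\theta_1}+1\right)b\,x_1}$, and consider the conditions: A: $i\notin K$; B1: $\zeta_7+\zeta_7^{-1}\notin K(i)$; B2: $\zeta_7\notin K(i,\zeta_7+\zeta_7^{-1})$; C: $\sqrt{\theta_1}\notin K(i,\zeta_7)$; D: $x_1\notin K(i,\zeta_7,\sqrt{\theta_1})$; E: $y_1\notin K(i,\zeta_7,x_1)$. Then the possible degrees $d=[K_7:K]$, together with the conditions that hold (the remaining ones failing), are: $d=96$: A, B1, B2, C, D, E; $d=48$: B1, E and three among A, B2, C, D; $d=32$: A, B2, C, D, E; $d=24$: B1, E, C, D; or B1, E, one between A and B2, and one between C and D; $d=16$: E and three among A, B2, C, D; $d=12$: B1, E and one among A, B2, C, D; $d=8$: E and two among A, B2, C, D; $d=6$: B1 and one among A, B2, E; $d=4$: A, B2; or E and one among A, B2, C, D; $d=3$: B1; $d=2$: one among A, B2, E; $d=1$: no condition holds.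
   Context: $\mathcal{E}[m]$ is the $m$-torsion subgroup and $K(\mathcal{E}[m])$ the field generated over $K$ by the coordinates of its points. Fix a root $i$ of $x^2+1$ and a primitive $7$th root of unity $\zeta_7$ (write $\zeta=\zeta_7$), and set $\omega_1=(6i+4)\zeta^5+(6i-2)\zeta^4+(2i-2)\zeta^3+(2i+4)\zeta^2+8i\zeta+4i-3$, $\theta_1=\frac17\big((-3520i-1568)\zeta^5+(-4800i+2352)\zeta^4+(-256i+2352)\zeta^3+(-1536i-1568)\zeta^2-5056i\zeta-2528i+3584\big)$. Square roots denote fixed choices in $\overline{K}$; $(x_1,y_1)$ is a point of exact order $7$ on $\mathcal{E}_1$. *)

(* Defs.v *)
From HB Require Import structures.
From mathcomp Require Import all_boot all_order all_algebra all_field.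
From mathcomp Require Export boolp.

Set Implicit Arguments.
Unset Strict Implicit.
Unset Printing Implicit Defensive.

Import GRing.Theory.
Local Open Scope ring_scope.

Section FieldsOver.
Variables (K L : fieldType) (iota : {rmorphism K -> L}).

(* [adjoin iota S] is the subfield K(S) of L, K being identified with its image
   under iota. Since 0^-1 = 0, the last constructor needs no side condition. *)
Inductive adjoin (S : L -> Prop) : L -> Prop :=
| adjoin_base a : adjoin S (iota a)
| adjoin_gen z : S z -> adjoin S z
| adjoin_add u v : adjoin S u -> adjoin S v -> adjoin S (u + v)
| adjoin_opp u : adjoin S u -> adjoin S (- u)
| adjoin_mul u v : adjoin S u -> adjoin S v -> adjoin S (u * v)
| adjoin_inv u : adjoin S u -> adjoin S u^-1.

Definition adjoin_seq (s : seq L) : L -> Prop := adjoin (fun z => z \in s).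

(* [E : K] = d: the K-subspace E of L has a K-basis with d elements. *)
Definition has_degree (E : L -> Prop) (d : nat) : Prop :=
  exists e : 'I_d -> L,
    [/\ forall j, E (e j),
        forall c : 'I_d -> K, \sum_j iota (c j) * e j = 0 -> forall j, c j = 0
      & forall z, E z -> exists c : 'I_d -> K, z = \sum_j iota (c j) * e j].

End FieldsOver.

Section EllipticCurve.
Variable F : fieldType.

Variant point := Infinity | Affine of F & F.

(* The curve y^2 = x^3 + a x + c; c does not occur in the addition formulas. *)
Variables a c : F.

Definition on_curve (P : point) : Prop :=
  if P is Affine x y then y ^+ 2 = x ^+ 3 + a * x + c else True.

(* Chord-and-tangent law, meaningful for points of the curve in
   characteristic different from 2. *)
Definition add_point (P Q : point) : point :=
  match P, Q with
  | Infinity, _ => Q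
  | _, Infinity => P
  | Affine x1 y1, Affine x2 y2 =>
    if (x1 == x2) && (y1 == - y2) then Infinity else
    let s := if x1 == x2 then (3 * x1 ^+ 2 + a) / (2 * y1)
             else (y2 - y1) / (x2 - x1) in
    let x3 := s ^+ 2 - x1 - x2 in
    Affine x3 (s * (x1 - x3) - y1)
  end.

Definition mul_point (m : nat) (P : point) : point :=
  iter m (add_point P) Infinity.

Definition torsion (m : nat) (P : point) : Prop :=
  on_curve P /\ mul_point m P = Infinity.

Definition torsion_coord (m : nat) (z : F) : Prop :=
  exists x y, torsion m (Affine x y) /\ (z = x \/ z = y).

End EllipticCurve.

Arguments Infinity {F}.

(* K(E[m]) for E : y^2 = x^3 + a x + c with a, c in K, Kbar being an algebraic
   closure of K. *)
Definition division_field (K : fieldType) (Kbar : closedFieldType)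
    (iota : {rmorphism K -> Kbar}) (a c : K) (m : nat) : Kbar -> Prop :=
  adjoin iota (torsion_coord (iota a) (iota c) m).

Definition omega1 (F : fieldType) (i zeta : F) : F :=
  (6 * i + 4) * zeta ^+ 5 + (6 * i - 2) * zeta ^+ 4 + (2 * i - 2) * zeta ^+ 3
  + (2 * i + 4) * zeta ^+ 2 + 8 * i * zeta + 4 * i - 3.

Definition theta1 (F : fieldType) (i zeta : F) : F :=
  7^-1 * ((- 3520 * i - 1568) * zeta ^+ 5 + (- 4800 * i + 2352) * zeta ^+ 4
          + (- 256 * i + 2352) * zeta ^+ 3 + (- 1536 * i - 1568) * zeta ^+ 2
          - 5056 * i * zeta - 2528 * i + 3584).

(* Sums of booleans count how many of the conditions hold; conditions not
   mentioned in an entry of the list are required to fail. *)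
Definition degree_table (d : nat) (A B1 B2 C D E : bool) : bool :=
  [|| (d == 96) && [&& A, B1, B2, C, D & E],
      (d == 48) && [&& B1, E & A + B2 + C + D == 3],
      (d == 32) && [&& A, ~~ B1, B2, C, D & E],
      (d == 24) && ([&& ~~ A, B1, ~~ B2, C, D & E]
                    || [&& B1, E, A + B2 == 1 & C + D == 1]),
      (d == 16) && [&& ~~ B1, E & A + B2 + C + D == 3],
      (d == 12) && [&& B1, E & A + B2 + C + D == 1],
      (d == 8) && [&& ~~ B1, E & A + B2 + C + D == 2],
      (d == 6) && [&& B1, ~~ C, ~~ D & A + B2 + E == 1],
      (d == 4) && ([&& A, ~~ B1, B2, ~~ C, ~~ D & ~~ E]
                   || [&& ~~ B1, E & A + B2 + C + D == 1]),
      (d == 3) && [&& ~~ A, B1, ~~ B2, ~~ C, ~~ D & ~~ E],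
      (d == 2) && [&& ~~ B1, ~~ C, ~~ D & A + B2 + E == 1]
    | (d == 1) && [&& ~~ A, ~~ B1, ~~ B2, ~~ C, ~~ D & ~~ E]]%N.

(* Main.v *)
(* A point (x, y) of y^2 = x^3 + b x is studied through t = x^2 / b, the
   invariant of the automorphism (x, y) |-> (-x, i y). It has order 7 iff t is a
   root of a polynomial psi7 of degree 12, which splits over Q(i, zeta) into the
   six conjugates of (t - omega1)^2 - theta1 / 4. The endomorphism 2 + i sends a
   root t of one factor to t ((t + c) / (c t + 1))^4 with c = 1 + 2 i, a root of
   the factor obtained by zeta |-> zeta^5; as 5 generates (Z/7)^*, a single point
   of order 7 together with i yields all the others rationally, so that
   K7 = K(i, zeta, x1, y1).

   The degree is then 2^(A + B2 + C + D + E) 3^B1, and the table only records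
   that B2 -> C -> D -> E: E[7] is free of rank one over Z[i]/7, so Gal(K7 / K(i))
   is cyclic, and in a cyclic extension of 2-power degree an upper quadratic step
   can be trivial only if the lower ones are. Concretely, the norm of each radicand
   is minus the square of a multiple of the generator of the previous step. *)

Require Import Defs.
From HB Require Import structures.
From mathcomp Require Import all_boot all_order all_algebra all_field.
From mathcomp Require Import boolp ring.

Set Implicit Arguments.
Unset Strict Implicit.
Unset Printing Implicit Defensive.

Import GRing.Theory.
Local Open Scope ring_scope.

(** * Subfields and degrees *)

Section Adjoin.
Variables (K L : fieldType) (iota : {rmorphism K -> L}).
Implicit Types (S : L -> Prop) (s : seq L).
Local Notation adj := (adjoin iota).
Local Notation adjs := (adjoin_seq iota).

Lemma adjoin_nat S n : adj S n%:R.
Proof. by rewrite -(rmorph_nat iota); apply: adjoin_base. Qed.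

Lemma adjoin0 S : adj S 0. Proof. exact: (adjoin_nat S 0). Qed.
Lemma adjoin1 S : adj S 1. Proof. exact: (adjoin_nat S 1). Qed.

Lemma adjoin_sub S u v : adj S u -> adj S v -> adj S (u - v).
Proof. by move=> Hu Hv; apply: adjoin_add => //; apply: adjoin_opp. Qed.

Lemma adjoin_div S u v : adj S u -> adj S v -> adj S (u / v).
Proof. by move=> Hu Hv; apply: adjoin_mul => //; apply: adjoin_inv. Qed.

Lemma adjoin_exp S u n : adj S u -> adj S (u ^+ n).
Proof.
by move=> Hu; elim: n => [|n IH]; rewrite ?exprS; [apply: adjoin1|apply: adjoin_mul].
Qed.

Lemma adjoin_sum S n (f : 'I_n -> L) : (forall j, adj S (f j)) -> adj S (\sum_j f j).
Proof. by move=> Hf; elim/big_ind: _ => //; [apply: adjoin0|apply: adjoin_add]. Qed.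

Lemma adjoin_sub_field S S' u :
  (forall z, S z -> adj S' z) -> adj S u -> adj S' u.
Proof.
move=> HS; elim=> [a|z /HS //|v w _ Hv _ Hw|v _ Hv|v w _ Hv _ Hw|v _ Hv].
- exact: adjoin_base.
- exact: adjoin_add.
- exact: adjoin_opp.
- exact: adjoin_mul.
- exact: adjoin_inv.
Qed.

Lemma adjoin_seq_sub s s' : (forall z, z \in s -> adjs s' z) ->
  forall u, adjs s u -> adjs s' u.
Proof. by move=> Hs u; apply: adjoin_sub_field. Qed.

Lemma adjoin_seq_mem s z : z \in s -> adjs s z.
Proof. exact: (@adjoin_gen _ _ iota (fun z => z \in s)). Qed.

Lemma adjoin_seq_cat s s' u : adjs s u -> adjs (s ++ s') u.
Proof.
by apply: adjoin_seq_sub => z zs; apply: adjoin_seq_mem; rewrite mem_cat zs.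
Qed.

End Adjoin.

Ltac adjoin_tac :=
  repeat first [assumption | exact: adjoin0 | exact: adjoin1 | exact: adjoin_nat
    | apply: adjoin_add | apply: adjoin_opp | apply: adjoin_exp | apply: adjoin_div
    | apply: adjoin_mul | apply: adjoin_inv].

(** * Degrees of successive adjunctions *)

Section Degree.
Variables (K L : fieldType) (iota : {rmorphism K -> L}).
Implicit Types s : seq L.
Local Notation adjs := (adjoin_seq iota).

Lemma has_degree_ext (E E' : L -> Prop) d : (forall z, E z <-> E' z) ->
  has_degree iota E d -> has_degree iota E' d.
Proof.
move=> EE' [e [He Hi Hs]]; exists e; split=> // [j|z /EE' /Hs //].
by apply/EE'.
Qed.

Lemma has_degree_base : has_degree iota (adjs [::]) 1.
Proof.
have base z : adjs [::] z -> exists a, z = iota a.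
  elim=> [a|//|_ _ _ [a ->] _ [b ->]|_ _ [a ->]|_ _ _ [a ->] _ [b ->]|_ _ [a ->]].
  - by exists a.
  - by exists (a + b); rewrite rmorphD.
  - by exists (- a); rewrite rmorphN.
  - by exists (a * b); rewrite rmorphM.
  - by exists a^-1; rewrite fmorphV.
exists (fun _ => 1); split=> [j|c|z /base[a ->]].
- exact: adjoin1.
- rewrite big_ord1 mulr1 => /eqP; rewrite fmorph_eq0 => /eqP c0 j.
  by rewrite ord1.
- by exists (fun _ => a); rewrite big_ord1 mulr1.
Qed.

Lemma sum_mxvec_index m n (f : 'I_(m * n) -> L) :
  \sum_k f k = \sum_p \sum_q f (mxvec_index p q).
Proof.
rewrite (reindex _ (curry_mxvec_bij _ _)) [RHS]pair_big /=.
by apply: eq_bigr => -[p q].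
Qed.

(** Products of a [K]-basis of [E] with the [E]-basis [w] of [E'] form a [K]-basis of [E'].
    Subfields are bare predicates on [L], so the stability of [E] under [K]-combinations is an
    explicit hypothesis. *)
Lemma has_degree_tower (E E' : L -> Prop) n (w : 'I_n -> L) d :
  (forall c : 'I_n -> L, (forall j, E (c j)) -> \sum_j c j * w j = 0 ->
     forall j, c j = 0) ->
  (forall z, E' z <-> exists2 c : 'I_n -> L, (forall j, E (c j))
     & z = \sum_j c j * w j) ->
  (forall d' (c : 'I_d' -> K) e, (forall j, E (e j)) -> E (\sum_j iota (c j) * e j)) ->
  E 0 -> has_degree iota E d -> has_degree iota E' (n * d).
Proof.
move=> Hind Hspan Elin E0 [e [He Hi Hs]].
(* Flattening the matrix of products by [mxvec] turns pairs of indices into elements of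
   ['I_(n * d)]. *)
pose M := (\matrix_(p < n, q < d) (e q * w p)).
exists (fun k => mxvec M 0 k); split=> [k|c Hc k|z].
- case/mxvec_indexP: k => p q; rewrite mxvecE mxE; apply/Hspan.
  exists (fun j => if j == p then e q else 0); first by move=> j; case: ifP.
  by rewrite (bigD1 p) //= eqxx big1 ?addr0 // => j /negPf ->; rewrite mul0r.
- case/mxvec_indexP: k => p q.
  have := Hind (fun p => \sum_q iota (c (mxvec_index p q)) * e q).
  move=> /(_ (fun j => Elin _ _ _ He)) H.
  apply: (Hi (fun q => c (mxvec_index p q))); apply: H.
  rewrite -[RHS]Hc sum_mxvec_index.
  apply: eq_bigr => p' _; rewrite mulr_suml; apply: eq_bigr => q' _.
  by rewrite mxvecE mxE mulrA.
- case/Hspan => c Ec ->.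
  have /choice[C HC] : forall p, exists C : 'I_d -> K, c p = \sum_j iota (C j) * e j.
    by move=> p; apply: Hs.
  exists (fun k => mxvec (\matrix_(p < n, q < d) C p q) 0 k).
  rewrite [RHS]sum_mxvec_index.
  apply: eq_bigr => p' _; rewrite HC mulr_suml; apply: eq_bigr => q' _.
  by rewrite !mxvecE !mxE mulrA.
Qed.

Lemma has_degree_span s z n d :
  (forall c : 'I_n -> L, (forall j, adjs s (c j)) ->
     \sum_j c j * z ^+ j = 0 -> forall j, c j = 0) ->
  (forall u, adjs (s ++ [:: z]) u -> exists2 c : 'I_n -> L,
     (forall j, adjs s (c j)) & u = \sum_j c j * z ^+ j) ->
  has_degree iota (adjs s) d -> has_degree iota (adjs (s ++ [:: z])) (n * d).
Proof.
move=> Hind Hspan; apply: (has_degree_tower (w := fun j : 'I_n => z ^+ j)) => //.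
- move=> u; split=> [|[c Hc ->]]; first exact: Hspan.
  apply: adjoin_sum => j; apply: adjoin_mul; first exact: adjoin_seq_cat.
  by apply: adjoin_exp; apply: adjoin_seq_mem; rewrite mem_cat mem_head orbT.
- move=> d' c e He; apply: adjoin_sum => j.
  by apply: adjoin_mul; [exact: adjoin_base|exact: He].
- exact: adjoin0.
Qed.

Lemma has_degree_trivial s z d : adjs s z ->
  has_degree iota (adjs s) d -> has_degree iota (adjs (s ++ [:: z])) d.
Proof.
move=> Hz; apply: has_degree_ext => u; split; first exact: adjoin_seq_cat.
apply: adjoin_seq_sub => v; rewrite mem_cat => /orP[vs|]; first exact: adjoin_seq_mem.
by rewrite inE => /eqP ->.
Qed.

(** * Quadratic steps *)

Section Quadratic.
Variables (s : seq L) (z p r : L).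
Hypotheses (Hp : adjs s p) (Hr : adjs s r) (Hz : z ^+ 2 = p * z + r).
Hypothesis nz : ~ adjs s z.

Lemma quadratic_free a b : adjs s a -> adjs s b -> a + b * z = 0 -> a = 0 /\ b = 0.
Proof.
move=> Ha Hb E; case: (eqVneq b 0) => [b0|nb].
  by move: E; rewrite b0 mul0r addr0.
case: nz; have -> : z = - a / b; last by apply: adjoin_div => //; apply: adjoin_opp.
apply: (mulfI nb); rewrite mulrCA divff // mulr1; apply: (addrI a).
by rewrite E subrr.
Qed.

Lemma quadratic_span u : adjs (s ++ [:: z]) u ->
  exists a b, [/\ adjs s a, adjs s b & u = a + b * z].
Proof.
elim=> [a|v||v|u1 u2 _ [a [b [Ha Hb ->]]] _ [a' [b' [Ha' Hb' ->]]]
       |v _ [a [b [Ha Hb ->]]]].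
- exists (iota a), 0; split; [exact: adjoin_base|exact: adjoin0|by rewrite mul0r addr0].
- rewrite mem_cat inE => /orP[vs|/eqP ->].
    by exists v, 0; split; [exact: adjoin_seq_mem|exact: adjoin0|rewrite mul0r addr0].
  by exists 0, 1; split; [exact: adjoin0|exact: adjoin1|rewrite mul1r add0r].
- move=> u1 u2 _ [a [b [Ha Hb ->]]] _ [a' [b' [Ha' Hb' ->]]].
  by exists (a + a'), (b + b'); split; [exact: adjoin_add|exact: adjoin_add|ring].
- move=> _ [a [b [Ha Hb ->]]].
  by exists (- a), (- b); split; [exact: adjoin_opp|exact: adjoin_opp|ring].
- exists (a * a' + b * b' * r), (a * b' + b * a' + b * b' * p); split; last by ring: Hz.
  + by apply: adjoin_add; apply: adjoin_mul => //; apply: adjoin_mul.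
  + apply: adjoin_add; [apply: adjoin_add|]; apply: adjoin_mul => //.
    exact: adjoin_mul.
(* The conjugate of [z] is [p - z], so [N] is the norm of [a + b z], and the inverse is the
   conjugate [a + b p - b z] divided by [N]. *)
- pose N := a ^+ 2 + a * b * p - b ^+ 2 * r.
  have EN : (a + b * z) * (a + b * p + (- b) * z) = N by rewrite /N; ring: Hz.
  have HN : adjs s N.
    apply: adjoin_sub; last by apply: adjoin_mul => //; apply: adjoin_exp.
    apply: adjoin_add; first exact: adjoin_exp.
    by apply: adjoin_mul => //; apply: adjoin_mul.
  have Habp : adjs s (a + b * p) by apply: adjoin_add => //; apply: adjoin_mul.
  case: (eqVneq (a + b * z) 0) => [->|nu].
    by rewrite invr0; exists 0, 0; split; [exact: adjoin0|exact: adjoin0|ring].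
  have nN : N != 0.
    rewrite -EN mulf_neq0 //; apply: contraNneq nu => E.
    have [E1 /eqP] := quadratic_free Habp (adjoin_opp Hb) E.
    rewrite oppr_eq0 => /eqP b0; move: E1; rewrite b0 mul0r addr0 => ->.
    by rewrite mul0r addr0.
  exists ((a + b * p) / N), (- b / N); split.
  + exact: adjoin_div.
  + by apply: adjoin_div => //; apply: adjoin_opp.
  + apply: (mulfI nu); rewrite divff // mulrAC -mulrDl mulrA EN divff //.
Qed.
End Quadratic.

Lemma has_degree_quadratic s z p r d :
  adjs s p -> adjs s r -> z ^+ 2 = p * z + r -> has_degree iota (adjs s) d ->
  has_degree iota (adjs (s ++ [:: z])) (2 ^ `[< ~ adjs s z >] * d).
Proof.
move=> Hp Hr Hz Hd; case: asboolP => [nz|/contrapT Hz']; last first.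
  by rewrite mul1n; apply: has_degree_trivial.
apply: has_degree_span Hd => [c Hc|u /(quadratic_span Hp Hr Hz nz)[a [b [Ha Hb ->]]]].
  rewrite !big_ord_recl big_ord0 /= expr0 expr1 mulr1 addr0 => E.
  have [c0 c1] := quadratic_free nz (Hc _) (Hc _) E.
  by case=> [[|[|//]]] Hj; [rewrite -c0|rewrite -c1]; congr c; apply: val_inj.
exists (fun j : 'I_2 => if j == 0 then a else b); first by move=> j; case: ifP.
by rewrite !big_ord_recl big_ord0 /= expr0 expr1 mulr1 addr0.
Qed.


(** * The cubic step: the field of 2 cos(2 pi / 7) *)

Section Cubic.
Variable s : seq L.
Let root c := c ^+ 3 = - c ^+ 2 + 2 * c + 1 :> L.

(** Angle doubling: for [c = z + 1/z] this is [z^2 + z^-2]. It generates the cyclic group of order 3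
    permuting the roots. *)
Lemma cubic_conj c : root c -> root (c ^+ 2 - 2).
Proof. by rewrite /root => Hc; ring: Hc. Qed.

(** The roots are [c], [c^2 - 2] and [1 - c - c^2], permuted cyclically by angle doubling, so each
    one is a polynomial in any other. *)
Lemma cubic_root_adjoin c l : root c -> root l -> adjs s l -> adjs s c.
Proof.
rewrite /root => Hc Hl sl.
have /eqP : (l - c) * ((l - (c ^+ 2 - 2)) * (l - (1 - c - c ^+ 2))) = 0 by ring: Hc Hl.
rewrite !mulf_eq0 !subr_eq0 => /or3P[] /eqP E.
- by rewrite -E.
- have -> : c = (l ^+ 2 - 2) ^+ 2 - 2 by rewrite E; ring: Hc.
  by adjoin_tac.
- have -> : c = l ^+ 2 - 2 by rewrite E; ring: Hc.
  by adjoin_tac.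
Qed.

(** A relation of degree 2 satisfied by [c] would divide the cubic; the remaining root would then
    lie in the base field and bring [c] with it. *)
Lemma cubic_free c a b d : root c -> ~ adjs s c ->
  adjs s a -> adjs s b -> adjs s d ->
  a + b * c + d * c ^+ 2 = 0 -> [/\ a = 0, b = 0 & d = 0].
Proof.
move=> Hc nc Ha Hb Hd E; case: (eqVneq d 0) => [d0|nd].
  move: E; rewrite d0 mul0r addr0 => /(quadratic_free nc Ha Hb) [-> ->] //.
case: nc; pose p := - b / d; pose r := - a / d.
have Hp : adjs s p by rewrite /p; adjoin_tac.
have Hr : adjs s r by rewrite /r; adjoin_tac.
have E2 : c ^+ 2 = p * c + r.
  apply: (mulfI nd).
  have -> : d * (p * c + r) = - (b * c + a) by rewrite /p /r; field.
  by apply: (addrI (a + b * c)); rewrite E; ring.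
(* The remainder of the cubic modulo [c^2 - p c - r]. *)
have E3 : (p * r + r - 1) + (p ^+ 2 + r + p - 2) * c = 0.
  have -> : (p * r + r - 1) + (p ^+ 2 + r + p - 2) * c
    = p * (p * c + r) + r * c + (p * c + r) - 2 * c - 1 by ring.
  have : c ^+ 3 = p * (p * c + r) + r * c.
    by rewrite exprS E2 mulrDr mulrCA -expr2 E2; ring.
  by rewrite Hc E2 => <-; ring.
case: (pselect (adjs s c)) => // nc.
have [||E4 E5] := quadratic_free nc _ _ E3; try by adjoin_tac.
(* The three roots sum to -1 and two of them to [p], which leaves [-1 - p]. *)
apply: (cubic_root_adjoin (l := - 1 - p)) => //; last by adjoin_tac.
apply/eqP; rewrite /root -subr_eq0; apply/eqP.
transitivity ((p ^+ 2 + r + p - 2) * (- 1 - p) + (p * r + r - 1)); first by ring.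
by rewrite E4 E5 mul0r addr0.
Qed.

Lemma cubic_span c u : root c -> ~ adjs s c -> adjs (s ++ [:: c]) u ->
  exists a b d, [/\ adjs s a, adjs s b, adjs s d & u = a + b * c + d * c ^+ 2].
Proof.
move=> Hc nc.
have spanM u1 u2 :
  (exists a b d, [/\ adjs s a, adjs s b, adjs s d & u1 = a + b * c + d * c ^+ 2]) ->
  (exists a b d, [/\ adjs s a, adjs s b, adjs s d & u2 = a + b * c + d * c ^+ 2]) ->
  exists a b d, [/\ adjs s a, adjs s b, adjs s d & u1 * u2 = a + b * c + d * c ^+ 2].
  move=> [a [b [d [Ha Hb Hd ->]]]] [a' [b' [d' [Ha' Hb' Hd' ->]]]].
  (* Coefficients reduced by the cubic and its consequence [c^4 = 3 c^2 - c - 1]. *)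
  exists (a * a' + (b * d' + d * b') - d * d'),
    (a * b' + b * a' + 2 * (b * d' + d * b') - d * d'),
    (a * d' + b * b' + d * a' - (b * d' + d * b') + 3 * d * d').
  by split; try adjoin_tac; move: Hc; rewrite /root => Hc; ring: Hc.
elim=> [a|v|u1 u2 _ [a [b [d [Ha Hb Hd ->]]]] _ [a' [b' [d' [Ha' Hb' Hd' ->]]]]
       |v _ [a [b [d [Ha Hb Hd ->]]]]|u1 u2 _ H1 _ H2|v _ [a [b [d [Ha Hb Hd ->]]]]].
- exists (iota a), 0, 0; split; try adjoin_tac; [exact: adjoin_base|by ring].
- rewrite mem_cat inE => /orP[vs|/eqP ->].
    have Sv : adjs s v by apply: adjoin_seq_mem.
    by exists v, 0, 0; split; try adjoin_tac; ring.
  by exists 0, 1, 0; split; try adjoin_tac; ring.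
- by exists (a + a'), (b + b'), (d + d'); split; try adjoin_tac; ring.
- by exists (- a), (- b), (- d); split; try adjoin_tac; ring.
- exact: spanM.
- case: (eqVneq (a + b * c + d * c ^+ 2) 0) => [->|nu].
    by rewrite invr0; exists 0, 0, 0; split; try adjoin_tac; ring.
  pose conj c' := a + b * c' + d * c' ^+ 2.
  have conj_neq0 c' : root c' -> (adjs s c' -> adjs s c) -> conj c' != 0.
    move=> Hc' sc'; apply: contraNneq nu => E.
    have nc' : ~ adjs s c' by move/sc'.
    have [-> -> ->] := cubic_free Hc' nc' Ha Hb Hd E.
    by rewrite !mul0r !addr0.
  have Hc1 := cubic_conj Hc; have Hc2 := cubic_conj Hc1.
  have n1 : conj (c ^+ 2 - 2) != 0.
    by apply: conj_neq0 => //; apply: cubic_root_adjoin.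
  have n2 : conj ((c ^+ 2 - 2) ^+ 2 - 2) != 0.
    by apply: conj_neq0 => //; apply: cubic_root_adjoin.
  (* [N] is the product of the three conjugates, so the inverse is the product of the other two
     divided by [N]. *)
  pose N := a ^+ 3 + b ^+ 3 + d ^+ 3 - a ^+ 2 * b + 5 * a ^+ 2 * d - 2 * a * b ^+ 2
    + 6 * a * d ^+ 2 - b ^+ 2 * d - 2 * b * d ^+ 2 - a * b * d.
  have EN : (a + b * c + d * c ^+ 2)
      * (conj (c ^+ 2 - 2) * conj ((c ^+ 2 - 2) ^+ 2 - 2)) = N.
    by move: Hc; rewrite /root /conj /N => Hc; ring: Hc.
  have HN : adjs s N by rewrite /N; adjoin_tac.
  have -> : (a + b * c + d * c ^+ 2)^-1
      = N^-1 * (conj (c ^+ 2 - 2) * conj ((c ^+ 2 - 2) ^+ 2 - 2)).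
    by rewrite -EN invfM mulfVK ?mulf_neq0.
  apply: (spanM).
    by exists N^-1, 0, 0; split; try adjoin_tac; ring.
  apply: (spanM).
    exists (a - 2 * b + 3 * d), (- d), (b - d).
    by split; try adjoin_tac; move: Hc; rewrite /root /conj => Hc; ring: Hc.
  exists (a + b + 2 * d), (d - b), (- b).
  by split; try adjoin_tac; move: Hc; rewrite /root /conj => Hc; ring: Hc.
Qed.
End Cubic.

Lemma has_degree_cubic s c d : c ^+ 3 = - c ^+ 2 + 2 * c + 1 ->
  has_degree iota (adjs s) d ->
  has_degree iota (adjs (s ++ [:: c])) (3 ^ `[< ~ adjs s c >] * d).
Proof.
move=> Hc Hd; case: asboolP => [nc|/contrapT sc]; last first.
  by rewrite mul1n; apply: has_degree_trivial.
apply: has_degree_span Hd => [f Hf|u /(cubic_span Hc nc)[a [b [e [Ha Hb He ->]]]]].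
  rewrite !big_ord_recl big_ord0 /= expr0 expr1 mulr1 addr0 addrA => E.
  have [f0 f1 f2] := cubic_free Hc nc (Hf _) (Hf _) (Hf _) E.
  by case=> [[|[|[|//]]]] Hj; [rewrite -f0|rewrite -f1|rewrite -f2];
    congr f; apply: val_inj.
exists (fun j : 'I_3 => if j == 0 then a else if j == 1 then b else e).
  by move=> j; case: ifP => // _; case: ifP.
by rewrite !big_ord_recl big_ord0 /= expr0 expr1 mulr1 addr0 addrA.
Qed.
End Degree.

(** * The 7-torsion of y^2 = x^3 + b x *)

Section GroupLaw.
Variables (F : fieldType) (a c : F).
Hypothesis n2 : (2 : F) != 0.

Local Notation "P ++ Q" := (add_point a P Q).

Definition opp_point (P : point F) : point F :=
  if P is Affine x y then Affine x (- y) else Infinity.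

Lemma opp_pointK : involutive opp_point.
Proof. by case=> //= x y; rewrite opprK. Qed.

Lemma add_point_opp P Q : opp_point P ++ opp_point Q = opp_point (P ++ Q).
Proof.
case: P => [|x1 y1]; case: Q => [|x2 y2] //=.
rewrite opprK eqr_oppLR; case: eqP => //= E.
  case: eqP => //= _; congr Affine; rewrite ?mulrN ?invrN ?mulrN; ring.
have n : x2 - x1 != 0 by rewrite subr_eq0 eq_sym; apply/eqP.
congr Affine; field; exact: n.
Qed.

(* The first equation determines the slope [s] also for a tangent, where the
   second one is void. *)
Lemma add_point_affine x1 y1 x2 y2 :
  on_curve a c (Affine x1 y1) -> on_curve a c (Affine x2 y2) ->
  ~~ ((x1 == x2) && (y1 == - y2)) ->
  exists s, [/\ s * (y1 + y2) = x1 ^+ 2 + x1 * x2 + x2 ^+ 2 + a,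
    y2 = y1 + s * (x2 - x1) & Affine x1 y1 ++ Affine x2 y2
      = Affine (s ^+ 2 - x1 - x2) (s * (x1 - (s ^+ 2 - x1 - x2)) - y1)].
Proof.
move=> /= H1 H2 nopp; rewrite (negPf nopp); eexists; split=> //.
  case: (eqVneq x1 x2) nopp => /= [E|n] nopp.
    subst x2.
    have E : y1 = y2.
      apply/eqP; rewrite -subr_eq0; apply/eqP.
      have /eqP: (y1 - y2) * (y1 + y2) = 0.
        by transitivity (y1 ^+ 2 - y2 ^+ 2); [ring|rewrite H1 H2 subrr].
      by rewrite mulf_eq0 [y1 + y2 == 0]addr_eq0 (negPf nopp) orbF => /eqP.
    have ny : y1 != 0.
      by apply: contraNneq nopp => y0; rewrite -E y0 oppr0.
    by subst y2; field; rewrite ?n2 ?ny.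
  have n' : x2 - x1 != 0 by rewrite subr_eq0 eq_sym.
  apply: (mulIf n'); rewrite mulrAC divfK //.
  transitivity (y2 ^+ 2 - y1 ^+ 2); first by ring.
  rewrite H1 H2; ring.
case: (eqVneq x1 x2) nopp => /= [E|n] nopp; last first.
  by field; rewrite subr_eq0 eq_sym.
subst x2; rewrite subrr mulr0 addr0; apply/eqP; rewrite -subr_eq0.
have /eqP: (y2 - y1) * (y1 + y2) = 0.
  by transitivity (y2 ^+ 2 - y1 ^+ 2); [ring|rewrite H1 H2 subrr].
by rewrite mulf_eq0 [y1 + y2 == 0]addr_eq0 (negPf nopp) orbF.
Qed.

Lemma add_point_on_curve P Q :
  on_curve a c P -> on_curve a c Q -> on_curve a c (P ++ Q).
Proof.
case: P => [|x1 y1] //; case: Q => [|x2 y2] // H1 H2.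
case: (boolP ((x1 == x2) && (y1 == - y2))) => [E|nopp]; first by rewrite /= E.
have [s [Hs Hl ->]] := add_point_affine H1 H2 nopp.
(* Solving the slope relation for [a] and the first point's equation for [c] leaves a polynomial
   identity in [x1], [x2], [y1] and [s]. *)
have Ea : a = s * (y1 + y2) - x1 ^+ 2 - x1 * x2 - x2 ^+ 2 by rewrite Hs; ring.
have Ec : c = y1 ^+ 2 - x1 ^+ 3 - a * x1 by move: H1 => /= ->; ring.
by rewrite /= Ec Ea Hl; ring.
Qed.

Lemma mul_point_on_curve m P : on_curve a c P -> on_curve a c (mul_point a m P).
Proof. by move=> HP; elim: m => //= m; apply: add_point_on_curve. Qed.

(** This instance of associativity suffices for all cancellations below. The line through -P and P +
    Q is the mirror image of the line through P and Q, so its slope is [- s], also when it is the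
    tangent at -P. *)
Lemma add_oppK x1 y1 Q : y1 != 0 -> on_curve a c (Affine x1 y1) ->
  on_curve a c Q -> Affine x1 (- y1) ++ (Affine x1 y1 ++ Q) = Q.
Proof.
case: Q => [|x2 y2] ny; first by rewrite /= !eqxx.
move=> H1 H2.
case: (boolP ((x1 == x2) && (y1 == - y2))) => [E|nopp].
  by rewrite /= E; case/andP: E => /eqP-> /eqP->; rewrite opprK.
have [s [Hs Hl ->]] := add_point_affine H1 H2 nopp; rewrite /=.
clear nopp H1 H2; set x3 := s ^+ 2 - x1 - x2.
have Hx : x2 = s ^+ 2 - x1 - x3 by rewrite /x3; ring.
have -> : - y1 == - (s * (x1 - x3) - y1) = (s * (x1 - x3) == 2 * y1).
  rewrite eqr_opp -[LHS]subr_eq0 -[RHS]subr_eq0 -[LHS]oppr_eq0.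
  by congr (_ == _); ring.
case: (eqVneq x1 x3) => /= [E3|n3].
  rewrite -E3 subrr mulr0 eq_sym mulf_eq0 (negPf n2) (negPf ny) /=.
  have -> : (3 * x1 ^+ 2 + a) / (2 * - y1) = - s.
    have Ea : 3 * x1 ^+ 2 + a = s * (2 * y1).
      transitivity (s * (y1 + y2) + 2 * x1 ^+ 2 - x1 * x2 - x2 ^+ 2).
        by rewrite Hs; ring.
      by rewrite Hl Hx -E3; ring.
    by rewrite Ea; field; rewrite ?oppr_eq0 ?n2 ?ny.
  by congr Affine; rewrite ?Hl Hx -?E3; ring.
have n' : x3 - x1 != 0 by rewrite subr_eq0 eq_sym.
have -> : (s * (x1 - x3) - y1 - - y1) / (x3 - x1) = - s by field.
by congr Affine; rewrite ?Hl Hx; ring.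
Qed.

Lemma add_point_eq_inf x1 y1 Q :
  Affine x1 y1 ++ Q = Infinity -> Q = Affine x1 (- y1).
Proof. by case: Q => //= x2 y2; case: ifP => // /andP[/eqP-> /eqP->]; rewrite opprK. Qed.

End GroupLaw.

(** * Multiples of a point as functions of [t] *)

Section SevenTorsion.
Variable F : fieldType.
Hypothesis n2 : (2 : F) != 0.

Let n4 : (4 : F) != 0. Proof. by rewrite (_ : 4 = 2 * 2) ?mulf_neq0 //; ring. Qed.
Let n8 : (8 : F) != 0. Proof. by rewrite (_ : 8 = 2 * 4) ?mulf_neq0 //; ring. Qed.
Let n16 : (16 : F) != 0. Proof. by rewrite (_ : 16 = 2 * 8) ?mulf_neq0 //; ring. Qed.

(* The division polynomials of index 7, 3 and 4 (the last one without its factor 4 y),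
   divided by powers of b and expressed in t = x^2 / b. *)
Definition psi7 (t : F) := 7 * (t ^+ 12 + 44 * t ^+ 11 - 422 * t ^+ 10 - 2836 * t ^+ 9
  - 5033 * t ^+ 8 - 8 * 1469 * t ^+ 7 - 4 * 3997 * t ^+ 6 - 8 * 753 * t ^+ 5
  + 2239 * t ^+ 4 + 2108 * t ^+ 3 + 186 * t ^+ 2 + 28 * t) - 1.

Definition psi3 (t : F) := 3 * t ^+ 2 + 6 * t - 1.
Definition psi4 (t : F) := (t - 1) * (t ^+ 2 + 6 * t + 1).

(** A point of order 7 is not killed by 2, 3 or 4. The resultants of [psi7] with these polynomials
    are powers of 2 up to sign, so characteristic 2 alone has to be excluded. *)
Lemma psi7_nondegenerate t : psi7 t = 0 ->
  [/\ t != 0, t + 1 != 0, psi3 t != 0 & psi4 t != 0].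
Proof.
have pow2 n : (2 : F) ^+ n != 0 by rewrite expf_neq0.
move=> Ht; have tn0 : t != 0.
  apply: contra_eq_neq Ht => ->.
  have -> : psi7 0 = -1 by rewrite /psi7; ring.
  by rewrite oppr_eq0 oner_neq0.
split=> //.
- apply: contra_eq_neq Ht => /eqP; rewrite addr_eq0 => /eqP ->.
  have -> : psi7 (-1) = - (2 : F) ^+ 12 by rewrite /psi7; ring.
  by rewrite oppr_eq0.
- apply: contra_eq_neq Ht => H0; set v := t^-1.
  (* Passing to [1/t] makes the relation monic, whatever becomes of the leading coefficient 3 of
     [psi3]. *)
  have Hv : v ^+ 2 = 6 * v + 3.
    have -> : v ^+ 2 = v ^+ 2 * (3 * t ^+ 2 + 6 * t - psi3 t) by rewrite /psi3; ring.
    by rewrite H0 /v; field.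
  have -> : psi7 t = t ^+ 12 * (2 ^+ 24 * (2521 + 5432 * v)).
    transitivity (t ^+ 12 * (7 * (1 + 44 * v - 422 * v ^+ 2 - 2836 * v ^+ 3
      - 5033 * v ^+ 4 - 8 * 1469 * v ^+ 5 - 4 * 3997 * v ^+ 6 - 8 * 753 * v ^+ 7
      + 2239 * v ^+ 8 + 2108 * v ^+ 9 + 186 * v ^+ 10 + 28 * v ^+ 11) - v ^+ 12)).
      by rewrite /psi7 /v; field.
    by congr (_ * _); ring: Hv.
  rewrite !mulf_neq0 ?expf_neq0 //.
  (* The conjugate of [v] is [6 - v]; the factor has norm 1 and is a unit. *)
  have E : (2521 + 5432 * v) * (2521 + 5432 * (6 - v)) = 1 by ring: Hv.
  by apply: contra_eq_neq E => ->; rewrite mul0r eq_sym oner_neq0.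
- rewrite /psi4 mulf_neq0 //.
    apply: contra_eq_neq Ht => /eqP; rewrite subr_eq0 => /eqP ->.
    have -> : psi7 1 = - (2 : F) ^+ 18 by rewrite /psi7; ring.
    by rewrite oppr_eq0.
  apply: contra_eq_neq Ht => H0.
  have H2 : t ^+ 2 = - 6 * t - 1 by apply: (addIr (6 * t + 1)); rewrite addrA H0; ring.
  have -> : psi7 t = 2 ^+ 21 * (1189 + 6930 * t) by rewrite /psi7; ring: H2.
  rewrite mulf_neq0 //.
  have E : (1189 + 6930 * t) * (1189 - 6930 * (6 + t)) = 1 by ring: H2.
  by apply: contra_eq_neq E => ->; rewrite mul0r eq_sym oner_neq0.
Qed.

Variables (b x y : F).
Hypotheses (nb : b != 0) (nx : x != 0) (ny : y != 0) (Hy : on_curve b 0 (Affine x y)).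
Let t := x ^+ 2 / b.
Let nt : t != 0. Proof. by rewrite mulf_neq0 ?expf_neq0 ?invr_neq0. Qed.
Let Eb : b = x ^+ 2 / t. Proof. by rewrite /t; field; rewrite nb nx. Qed.
Let Ey : y ^+ 2 = x ^+ 3 * ((t + 1) / t).
Proof. by move: Hy => /= ->; rewrite {1}Eb; field. Qed.
Let nt1 : t + 1 != 0.
Proof. by apply: contraNneq ny => t1; rewrite -sqrf_eq0 Ey t1 mul0r mulr0. Qed.

(** After scaling by [x] and [y] the addition law involves [t] only: the slope is [(y / x) m], and
    [y^2 / x^3 = (t + 1) / t]. *)
Lemma add_scaled f g m : f != 1 -> g - 1 = m * (f - 1) ->
  let f' := (t + 1) / t * m ^+ 2 - 1 - f in
  add_point b (Affine x y) (Affine (x * f) (y * g))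
  = Affine (x * f') (y * (m * (1 - f') - 1)).
Proof.
move=> nf Hg f' /=.
have n1 : x != x * f by rewrite -{1}[x]mulr1 (inj_eq (mulfI nx)) eq_sym.
rewrite (negPf n1) /=.
have -> : (y * g - y) / (x * f - x) = y / x * m.
  have -> : y * g - y = y * (m * (f - 1)) by rewrite -Hg; ring.
  have nd : x * f - x != 0 by rewrite subr_eq0 eq_sym.
  by field; rewrite ?nx ?nd.
have -> : (y / x * m) ^+ 2 - x - x * f = x * f'.
  rewrite !exprMn Ey /f'; field; by rewrite nx nt.
by congr Affine; field.
Qed.

(* k (x, y) = (x fk(t), y gk(t)), and the fraction [mk] is the slope of the line through
   (x, y) and (k-1) (x, y), divided by y / x. *)
Definition f2 t := (t - 1) ^+ 2 / (4 * t * (t + 1)) : F.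
Definition g2 t := psi4 t / (8 * t * (t + 1) ^+ 2) : F.
Definition f3 t := ((t ^+ 2 - 6 * t - 3) / psi3 t) ^+ 2 : F.
Definition g3 t := (t ^+ 6 + 22 * t ^+ 5 - 165 * t ^+ 4 - 92 * t ^+ 3 - 185 * t ^+ 2
  - 90 * t - 3) / psi3 t ^+ 3 : F.

Definition m3 t := (7 * t ^+ 3 + 11 * t ^+ 2 + 13 * t + 1) / (2 * (t + 1) * psi3 t) : F.
Definition m4 t := (13 * t ^+ 6 + 70 * t ^+ 5 + 231 * t ^+ 4 + 100 * t ^+ 3 + 43 * t ^+ 2
  + 54 * t + 1) / (4 * (t + 1) * psi4 t * psi3 t) : F.
Definition f4 t := (t + 1) / t * m4 t ^+ 2 - 1 - f3 t.

Let Q := Affine x y.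

Lemma mul2E : mul_point b 2 Q = Affine (x * f2 t) (y * g2 t).
Proof.
have nyy : (y == - y) = false.
  by rewrite -[LHS]subr_eq0 opprK -mulr2n -mulr_natl mulf_eq0 (negPf n2) (negPf ny).
rewrite /mul_point /= eqxx nyy /=.
have -> : (3 * x ^+ 2 + b) / (2 * y) = y / x * ((3 * t + 1) / (2 * (t + 1))).
  transitivity (y * ((3 * x ^+ 2 + b) / (2 * y ^+ 2))); first by field; rewrite ny n2.
  by rewrite Ey {1}Eb; field; rewrite nx n2 nt1 nt.
have E : (y / x * ((3 * t + 1) / (2 * (t + 1)))) ^+ 2 - x - x = x * f2 t.
  rewrite !exprMn Ey /f2; field; by rewrite ?nt1 ?nt ?nx ?n2 ?n4 ?n8 ?n16.
rewrite E; congr Affine; rewrite /f2 /g2 /psi4; field.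
by rewrite ?nt1 ?nt ?nx ?n2 ?n4 ?n8 ?n16.
Qed.

(** 2Q and Q share their abscissa exactly when 3Q = 0, whence [psi3]. *)
Lemma f2_neq1 : (f2 t != 1) = (psi3 t != 0).
Proof.
have -> : (f2 t != 1) = (f2 t - 1 != 0) by rewrite subr_eq0.
have -> : f2 t - 1 = - psi3 t / (4 * t * (t + 1)).
  by rewrite /f2 /psi3; field; rewrite ?nt ?nt1 ?n2 ?n4 ?n8 ?n16.
have nd : 4 * t * (t + 1) != 0 by rewrite mulf_neq0 // mulf_neq0.
by rewrite mulf_eq0 oppr_eq0 invr_eq0 (negPf nd) orbF.
Qed.

Lemma g3E : psi3 t != 0 -> g3 t = m3 t * (1 - f3 t) - 1.
Proof.
by rewrite /f3 /g3 /m3 /psi3 => n3; field; rewrite ?n3 ?nt ?nt1 ?n2.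
Qed.

Lemma mul3E : psi3 t != 0 -> mul_point b 3 Q = Affine (x * f3 t) (y * g3 t).
Proof.
move=> n3; rewrite /mul_point iterS -/(mul_point b 2 Q) mul2E.
have := n3; rewrite -f2_neq1 => nf.
rewrite (@add_scaled _ _ (m3 t)) //.
  have E : (t + 1) / t * m3 t ^+ 2 - 1 - f2 t = f3 t.
    move: n3; rewrite /f2 /f3 /m3 /psi3 => n3; field.
    by rewrite ?n3 ?nt ?nt1 ?n2 ?n4 ?n8 ?n16.
  by rewrite E -g3E.
move: n3; rewrite /f2 /g2 /m3 /psi3 /psi4 => n3; field.
by rewrite ?n3 ?nt ?nt1 ?n2 ?n4 ?n8 ?n16.
Qed.

(** 3Q = Q or 3Q = -Q means that 2Q or 4Q vanishes; the factor [t + 1] of the first case is nonzero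
    because [y] is. *)
Lemma f3_neq1 : psi3 t != 0 -> (f3 t != 1) = (psi4 t != 0).
Proof.
move=> n3.
have -> : (f3 t != 1) = (f3 t - 1 != 0) by rewrite subr_eq0.
have -> : f3 t - 1 = - 8 * (psi4 t * (t + 1)) / psi3 t ^+ 2.
  by move: n3; rewrite /f3 /psi3 /psi4 => n3; field.
have n8' : (- 8 : F) != 0 by rewrite oppr_eq0.
rewrite mulf_eq0 invr_eq0 expf_eq0 (negPf n3) orbF mulf_eq0 (negPf n8').
by rewrite mulf_eq0 (negPf nt1) orbF.
Qed.

Lemma g3_m4 : psi3 t != 0 -> psi4 t != 0 -> g3 t - 1 = m4 t * (f3 t - 1).
Proof.
rewrite /g3 /m4 /f3 /psi3 /psi4 => n3; rewrite mulf_eq0 negb_or => /andP[n5 n5'].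
by field; rewrite ?n3 ?n5 ?n5' ?nt1 ?n2 ?n4 ?n8 ?n16.
Qed.

Lemma mul4E : psi3 t != 0 -> psi4 t != 0 ->
  mul_point b 4 Q = Affine (x * f4 t) (y * (m4 t * (1 - f4 t) - 1)).
Proof.
move=> n3 n5; rewrite /mul_point iterS -/(mul_point b 3 Q) mul3E //.
by rewrite (add_scaled _ (g3_m4 n3 n5)) // f3_neq1.
Qed.

(** This difference is the source of [psi7]: 4Q and 3Q share their abscissa exactly when 7Q = 0. *)
Lemma f4_sub_f3 : psi3 t != 0 -> psi4 t != 0 ->
  f4 t - f3 t = - psi7 t / (16 * t * (t + 1) * psi4 t ^+ 2 * psi3 t ^+ 2).
Proof.
rewrite /f4 /m4 /f3 /psi3 /psi4 => n3; rewrite mulf_eq0 negb_or => /andP[n5 n5'].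
by rewrite /psi7; field; rewrite ?n3 ?n5 ?n5' ?nt1 ?nt ?n2 ?n4 ?n8 ?n16.
Qed.

Lemma mul_point_period k m P :
  mul_point b m P = Infinity -> mul_point b (k + m) P = mul_point b k P.
Proof. by move=> Hm; rewrite /mul_point iterD -/(mul_point b m P) Hm. Qed.

(* Cancelling (x, y) repeatedly in 7 (x, y) = 0 turns it into 4 (x, y) = - 3 (x, y). *)
Lemma mul7_eq_inf : (mul_point b 7 Q = Infinity) <-> (psi7 t = 0).
Proof.
have mS m : mul_point b m.+1 Q = add_point b Q (mul_point b m Q) by [].
have HC m : on_curve b 0 (mul_point b m Q) by apply: mul_point_on_curve.
split=> [H7|H0]; last first.
  have [_ _ n3 n5] := psi7_nondegenerate H0.
  have E4 : mul_point b 4 Q = opp_point (mul_point b 3 Q).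
    have Ef : f4 t = f3 t.
      by apply/eqP; rewrite -subr_eq0 f4_sub_f3 // H0 oppr0 mul0r.
    rewrite mul4E // mul3E //= Ef; congr Affine.
    have -> : g3 t = m4 t * (f3 t - 1) + 1 by rewrite -g3_m4 //; ring.
    by ring.
  (* Three applications to 4Q = -3Q lead up to 7Q = 0. *)
  have back m : add_point b Q (opp_point (mul_point b m.+1 Q))
      = opp_point (mul_point b m Q).
    rewrite mS -{1}[Q]opp_pointK add_point_opp; congr opp_point.
    exact: (add_oppK n2 ny Hy (HC m)).
  by rewrite mS (mS 5) (mS 4) E4 !back.
(* Strips one summand Q at a time: 6Q = -Q, then 5Q = -2Q, then 4Q = -3Q. *)
have fwd m R : on_curve b 0 R -> add_point b Q R = opp_point (mul_point b m Q) ->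
    R = opp_point (mul_point b m.+1 Q).
  move=> HR E; rewrite -(add_oppK n2 ny Hy HR) E mS.
  by rewrite -add_point_opp.
(* Otherwise 2Q = -Q, so 3Q = 0 and 7Q = Q, which is affine. *)
have n3 : psi3 t != 0.
  rewrite -f2_neq1; apply/negP => /eqP E.
  have E3 : mul_point b 3 Q = Infinity.
    have g2E : g2 t = (3 * t + 1) / (2 * (t + 1)) * (1 - f2 t) - 1.
      by rewrite /f2 /g2 /psi4; field; rewrite ?nt ?nt1 ?n2 ?n4 ?n8.
    by rewrite mS mul2E g2E E subrr mulr0 sub0r mulr1 mulrN1 /= opprK !eqxx.
  have := H7; rewrite (mul_point_period 4 E3) (mul_point_period 1 E3).
  by rewrite /mul_point /=.
(* Otherwise 3Q = -Q, so 4Q = 0 and 7Q = 3Q, which is affine. *)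
have n5 : psi4 t != 0.
  rewrite -f3_neq1 //; apply/negP => /eqP E.
  have E4 : mul_point b 4 Q = Infinity.
    by rewrite mS mul3E // g3E // E subrr mulr0 sub0r mulr1 mulrN1 /= opprK !eqxx.
  by have := H7; rewrite (mul_point_period 3 E4) mul3E.
have E6 : mul_point b 6 Q = opp_point (mul_point b 1 Q).
  by move: H7; rewrite mS => /add_point_eq_inf ->.
have E5 := fwd _ _ (HC 5) E6; have E4 := fwd _ _ (HC 4) E5.
move: E4; rewrite mul4E // mul3E //= => -[/(mulfI nx) E _].
have := f4_sub_f3 n3 n5; rewrite E subrr => /eqP.
rewrite eq_sym mulf_eq0 oppr_eq0 invr_eq0.
have nd : 16 * t * (t + 1) * psi4 t ^+ 2 * psi3 t ^+ 2 != 0.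
  by do 4! rewrite mulf_neq0 ?expf_neq0 //.
by rewrite (negPf nd) orbF => /eqP.
Qed.
End SevenTorsion.

Lemma torsion7E (F : fieldType) (b x y : F) : (2 : F) != 0 -> b != 0 ->
  torsion b 0 7 (Affine x y) <-> y ^+ 2 = x ^+ 3 + b * x /\ psi7 (x ^+ 2 / b) = 0.
Proof.
move=> n2 nb.
have oc : on_curve b 0 (Affine x y) <-> y ^+ 2 = x ^+ 3 + b * x by rewrite /= addr0.
rewrite /torsion; case: (eqVneq y 0) => [y0|ny].
  (* A point with [y = 0] has order 2, so its 7th multiple is itself; conversely
     [t (t + 1) = x y^2 / b^2] would vanish at a root of [psi7]. *)
  split=> -[/oc Hy H7].
    have E2 : mul_point b 2 (Affine x y) = Infinity.
      by rewrite /mul_point /= y0 oppr0 !eqxx.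
    have := H7; rewrite (mul_point_period 5 E2) (mul_point_period 3 E2).
    by rewrite (mul_point_period 1 E2).
  have [tn0 tn1 _ _] := psi7_nondegenerate n2 H7.
  have /eqP : (x ^+ 2 / b) * ((x ^+ 2 / b) + 1) = 0.
    have -> : (x ^+ 2 / b) * ((x ^+ 2 / b) + 1) = x * (x ^+ 3 + b * x) / b ^+ 2 by field.
    by move/oc: Hy => <-; rewrite y0 expr0n /= mulr0 mul0r.
  by rewrite mulf_eq0 (negPf tn0) (negPf tn1).
have nx : y ^+ 2 = x ^+ 3 + b * x -> x != 0.
  by move=> E; apply: contraNneq ny => x0; rewrite -sqrf_eq0 E x0 expr0n mulr0 addr0.
split=> -[Hy H7]; split; try by apply/oc.
  have Hy' := proj1 oc Hy.
  by have [/(_ H7)] := mul7_eq_inf n2 nb (nx Hy') ny Hy.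
by have [_ /(_ H7)] := mul7_eq_inf n2 nb (nx Hy) ny (proj2 oc Hy).
Qed.

(** * The splitting of psi7 over Q(i, zeta) *)

Section Splitting.
Variable F : fieldType.
Implicit Types (e t : F).

(* omega1 and theta1 lie in the sextic field generated by e = i (zeta - 1/zeta), whose
   minimal polynomial is [eps_root]: omega1 = omega_eps e and
   7 theta1 = 16 disc_eps e. The automorphism zeta |-> zeta^5, i |-> i acts by
   [eps_conj], of order 6, and multiplies disc_eps by - disc_ratio^2. *)
Definition omega_eps e := 1 + 8 * e + 4 * e ^+ 2 - 8 * e ^+ 3 - 2 * e ^+ 4 + 2 * e ^+ 5.
Definition disc_eps e :=
  322 - 42 * e - 490 * e ^+ 2 + 168 * e ^+ 3 + 147 * e ^+ 4 - 62 * e ^+ 5.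
Definition quad e t := 7 * (t - omega_eps e) ^+ 2 - 4 * disc_eps e.
Definition eps_conj e := e ^+ 5 - 5 * e ^+ 3 + 5 * e.
Definition disc_ratio e :=
  - 58 - 37 * e + 95 * e ^+ 2 + 59 * e ^+ 3 - 23 * e ^+ 4 - 14 * e ^+ 5.
Definition eps_root e := e ^+ 6 = 7 * e ^+ 4 - 14 * e ^+ 2 + 7.

Lemma eps_root_conj e : eps_root e -> eps_root (eps_conj e).
Proof. rewrite /eps_root /eps_conj => He. ring: He. Qed.

Lemma eps_root_opp e : eps_root e -> eps_root (- e).
Proof. rewrite /eps_root => He. ring: He. Qed.

(** [eps_conj] is the Dickson polynomial of degree 5. For [e = w + 1/w] with [w = i zeta] of order
    28, iterating it gives [w^25 + w^-25 = w^3 + w^-3], the Dickson polynomial of degree 3. *)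
Lemma eps_conj2 e : eps_root e -> eps_conj (eps_conj e) = e ^+ 3 - 3 * e.
Proof. rewrite /eps_root /eps_conj => He. ring: He. Qed.

Lemma eps_conj3 e : eps_root e -> eps_conj (eps_conj (eps_conj e)) = - e.
Proof.
move=> He; rewrite (eps_conj2 He) /eps_conj.
move: He; rewrite /eps_root => He; ring: He.
Qed.

(** One seventh of the norm of [quad] from Q(e) to the cubic field Q(e^2). *)
Definition quad_norm e t := 7 * t ^+ 4 + (56 * e ^+ 4 - 112 * e ^+ 2 - 28) * t ^+ 3
   + (- 56 * e ^+ 4 + 224 * e ^+ 2 - 182) * t ^+ 2
   + (- 56 * e ^+ 4 + 336 * e ^+ 2 - 476) * t + (- 72 * e ^+ 4 + 448 * e ^+ 2 - 665).

Lemma quad_norm_spec e t : eps_root e -> quad e t * quad (- e) t = 7 * quad_norm e t.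
Proof. rewrite /eps_root /quad /quad_norm /omega_eps /disc_eps => He. ring: He. Qed.

Lemma quad_norm_prod e t : eps_root e ->
  quad_norm e t * quad_norm (eps_conj e) t * quad_norm (eps_conj (eps_conj e)) t
  = 49 * psi7 t.
Proof.
move=> He; rewrite eps_conj2 //.
(* The conjugate factors are first reduced modulo [eps_root], which keeps the final identity
   small. *)
have -> : quad_norm (eps_conj e) t
    = 7 * t ^+ 4 + (- 168 * e ^+ 4 + 728 * e ^+ 2 - 420) * t ^+ 3
    + (56 * e ^+ 4 - 280 * e ^+ 2 + 210) * t ^+ 2
    + (- 56 * e ^+ 4 + 168 * e ^+ 2 - 84) * t + (- 88 * e ^+ 4 + 280 * e ^+ 2 - 161).
  move: He; rewrite /eps_root /quad_norm /eps_conj => He. ring: He.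
have -> : quad_norm (e ^+ 3 - 3 * e) t
    = 7 * t ^+ 4 + (112 * e ^+ 4 - 616 * e ^+ 2 + 756) * t ^+ 3
    + (56 * e ^+ 2 - 182) * t ^+ 2
    + (112 * e ^+ 4 - 504 * e ^+ 2 + 308) * t + (160 * e ^+ 4 - 728 * e ^+ 2 + 455).
  move: He; rewrite /eps_root /quad_norm /eps_conj => He. ring: He.
move: He; rewrite /eps_root /quad_norm /psi7 => He. ring: He.
Qed.

Lemma psi7_eq0 e t : (7 : F) != 0 -> eps_root e -> (psi7 t == 0) =
  [|| quad e t == 0, quad (eps_conj e) t == 0, quad (eps_conj (eps_conj e)) t == 0,
      quad (- e) t == 0, quad (- eps_conj e) t == 0
    | quad (- eps_conj (eps_conj e)) t == 0].
Proof.
move=> n7 He.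
have H1 := quad_norm_spec t He; have H2 := quad_norm_spec t (eps_root_conj He).
have H3 := quad_norm_spec t (eps_root_conj (eps_root_conj He)).
have E : (quad e t * quad (- e) t) * (quad (eps_conj e) t * quad (- eps_conj e) t)
    * (quad (eps_conj (eps_conj e)) t * quad (- eps_conj (eps_conj e)) t)
    = 7 ^+ 5 * psi7 t.
  rewrite H1 H2 H3; have := quad_norm_prod t He.
  by move: (quad_norm e t) (quad_norm _ t) (quad_norm _ t) (psi7 t) => a b c f E; ring: E.
have -> : (psi7 t == 0) = (7 ^+ 5 * psi7 t == 0).
  by rewrite mulf_eq0 expf_eq0 /= (negPf n7).
by rewrite -E !mulf_eq0; do 6 case: (_ == 0).
Qed.

(** As -1 is the square of [i], a root of one factor yields, with [i] and [e], the roots of the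
    next. *)
Lemma disc_eps_conj e : eps_root e ->
  disc_eps (eps_conj e) = - (disc_ratio e ^+ 2 * disc_eps e).
Proof. rewrite /eps_root /disc_eps /disc_ratio /eps_conj => He. ring: He. Qed.

(** * The endomorphism 2 + i on the roots of [quad] *)

Section CM.
Variables (e t i : F).
Hypotheses (He : eps_root e) (Hi : i ^+ 2 = -1).
Let c := 1 + 2 * i.

(* For a root t of quad e, the elements u = (t + c) / (c t + 1), u^2 and u^4 of
   Q(i, e)[t] are (a0 + a1 t) / 8, (b0 + b1 t) / 4 and c0 + c1 t. *)
Definition cm_a1 e i := 14 + 14 * e - 25 * e ^+ 2 - 20 * e ^+ 3 + 7 * e ^+ 4 + 5 * e ^+ 5
  + i * (- 28 - 12 * e + 45 * e ^+ 2 + 20 * e ^+ 3 - 11 * e ^+ 4 - 5 * e ^+ 5) : F.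
Definition cm_a0 e i := 10 + 2 * e - 19 * e ^+ 2 - 12 * e ^+ 3 + 5 * e ^+ 4 + 3 * e ^+ 5
  + i * (- 20 + 4 * e + 27 * e ^+ 2 - 4 * e ^+ 3 - 5 * e ^+ 4 + e ^+ 5) : F.
Definition cm_b1 e i := 14 + 5 * e - 27 * e ^+ 2 - 9 * e ^+ 3 + 10 * e ^+ 4 + 4 * e ^+ 5
  + i * (42 + 27 * e - 68 * e ^+ 2 - 45 * e ^+ 3 + 17 * e ^+ 4 + 11 * e ^+ 5) : F.
Definition cm_b0 e i := -10 - 13 * e + 17 * e ^+ 2 + 25 * e ^+ 3 - 4 * e ^+ 4 - 6 * e ^+ 5
  + i * (10 + 21 * e - 18 * e ^+ 2 - 31 * e ^+ 3 + 5 * e ^+ 4 + 7 * e ^+ 5) : F.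
Definition cm_c1 e i := -119 - 68 * e + 202 * e ^+ 2 + 114 * e ^+ 3 - 58 * e ^+ 4 - 32 * e ^+ 5
  + i * (98 + 53 * e - 161 * e ^+ 2 - 87 * e ^+ 3 + 41 * e ^+ 4 + 22 * e ^+ 5) : F.
Definition cm_c0 e i := -42 - 32 * e + 68 * e ^+ 2 + 52 * e ^+ 3 - 16 * e ^+ 4 - 12 * e ^+ 5
  + i * (26 - 3 * e - 39 * e ^+ 2 + 5 * e ^+ 3 + 7 * e ^+ 4 - 2 * e ^+ 5) : F.

(** In this and the next three identities the error is an explicit multiple of [quad e t]; the
    factor 7 is the leading coefficient of [quad]. *)
Lemma cm_a_spec :
  7 * ((cm_a0 e i + cm_a1 e i * t) * (c * t + 1) - 8 * (t + c))
  = cm_a1 e i * c * quad e t.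
Proof.
move: He; rewrite /eps_root /cm_a0 /cm_a1 /quad /omega_eps /disc_eps /c => He'.
by ring: He' Hi.
Qed.

Lemma cm_b_spec :
  7 * ((cm_a0 e i + cm_a1 e i * t) ^+ 2 - 16 * (cm_b0 e i + cm_b1 e i * t))
  = cm_a1 e i ^+ 2 * quad e t.
Proof.
move: He; rewrite /eps_root /cm_a0 /cm_a1 /cm_b1 /cm_b0 /quad /omega_eps /disc_eps.
by move=> He'; ring: He' Hi.
Qed.

Lemma cm_c_spec :
  7 * ((cm_b0 e i + cm_b1 e i * t) ^+ 2 - 16 * (cm_c0 e i + cm_c1 e i * t))
  = cm_b1 e i ^+ 2 * quad e t.
Proof.
move: He; rewrite /eps_root /cm_c0 /cm_c1 /cm_b1 /cm_b0 /quad /omega_eps /disc_eps.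
by move=> He'; ring: He' Hi.
Qed.

(** Identifies [t u^4] with a root of the next factor, in the form that [disc_eps_conj] predicts. *)
Lemma cm_c_mul :
  7 * (t * (cm_c0 e i + cm_c1 e i * t)
       - (omega_eps (eps_conj e) + i * disc_ratio e * (t - omega_eps e)))
  = cm_c1 e i * quad e t.
Proof.
move: He; rewrite /eps_root /cm_c0 /cm_c1 /disc_ratio /eps_conj /quad.
by rewrite /omega_eps /disc_eps => He'; ring: He' Hi.
Qed.
End CM.
End Splitting.

(** * The sextic field inside Q(i, zeta) *)

Section Cyclotomic.
Variables (F : fieldType) (i z : F).
Hypotheses (Hi : i ^+ 2 + 1 = 0) (Hz : 7.-primitive_root z).

Lemma sqr_i : i ^+ 2 = -1.
Proof. by apply/eqP; rewrite -subr_eq0 opprK Hi. Qed.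

Lemma zeta6E : z ^+ 6 = - (z ^+ 5 + z ^+ 4 + z ^+ 3 + z ^+ 2 + z + 1).
Proof.
have nz : z - 1 != 0.
  rewrite subr_eq0; apply/negP => /eqP z1.
  by have := prim_order_dvd Hz 1; rewrite expr1 z1 eqxx.
apply/eqP; rewrite -subr_eq0 -(mulrI_eq0 _ (lregP nz)); apply/eqP.
by transitivity (z ^+ 7 - 1); [ring|rewrite (prim_expr_order Hz) subrr].
Qed.

Lemma zetaV : z^-1 = z ^+ 6.
Proof.
have nz : z != 0.
  apply: contra_eq_neq (prim_expr_order Hz) => ->.
  by rewrite expr0n /= eq_sym oner_neq0.
by apply: (mulfI nz); rewrite divff // -exprS (prim_expr_order Hz).
Qed.

Definition eps (i z : F) := i * (z - z^-1).
Let e := eps i z.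
Let c := z + z^-1.

Lemma eps_rootP : eps_root e.
Proof.
have := sqr_i; have := zeta6E; rewrite /eps_root /e /eps zetaV => H6 Hi'.
rewrite H6; ring: H6 Hi'.
Qed.

Lemma omega1E : omega1 i z = omega_eps e.
Proof.
have := sqr_i; have := zeta6E; rewrite /omega1 /omega_eps /e /eps zetaV => H6 Hi'.
rewrite H6; ring: H6 Hi'.
Qed.

Lemma theta1E : (7 : F) != 0 -> 7 * theta1 i z = 16 * disc_eps e.
Proof.
move=> n7; rewrite /theta1 mulrA divff // mul1r.
have := sqr_i; have := zeta6E; rewrite /disc_eps /e /eps zetaV => H6 Hi'.
rewrite H6; ring: H6 Hi'.
Qed.

Lemma cos_cubic : c ^+ 3 = - c ^+ 2 + 2 * c + 1.
Proof. by have H6 := zeta6E; rewrite /c zetaV H6; ring: H6. Qed.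

Lemma zeta_quadratic : z ^+ 2 = c * z + (- 1).
Proof. by have H6 := zeta6E; rewrite /c zetaV H6; ring: H6. Qed.

Lemma cos_eps : c = - e ^+ 4 + 5 * e ^+ 2 - 5.
Proof.
have := sqr_i; have := zeta6E; rewrite /c /e /eps zetaV => H6 Hi'.
rewrite H6; ring: H6 Hi'.
Qed.

(** Where 2 is invertible, [z] and [e] generate the same extension of a field containing [i] and
    [c]. *)
Lemma zeta_eps : 2 * z = c - i * e.
Proof.
by have Hi' := sqr_i; rewrite /c /e /eps; ring: Hi'.
Qed.

Lemma sqr_eps : e ^+ 2 = 4 - c ^+ 2.
Proof.
have := sqr_i; have := zeta6E; rewrite /c /e /eps zetaV => H6 Hi'.
rewrite H6; ring: H6 Hi'.
Qed.
End Cyclotomic.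

(** * Norms of the radicands *)

Section NormIdentities.
Variables (F : fieldType) (e : F).
Hypothesis He : eps_root e.

Lemma eps_conj_opp : eps_conj (- e) = - eps_conj e.
Proof. rewrite /eps_conj; ring. Qed.

(** The differences keep the odd part of [omega_eps], and the coefficients 5, -3, -1 isolate [e]
    among the conjugates. This brings [e] into the division field. *)
Lemma eps_from_omega : 56 * e = 5 * (omega_eps e - omega_eps (- e))
  - 3 * (omega_eps (eps_conj e) - omega_eps (- eps_conj e))
  - (omega_eps (eps_conj (eps_conj e)) - omega_eps (- eps_conj (eps_conj e))).
Proof.
rewrite (eps_conj2 He); move: He; rewrite /eps_root /omega_eps /eps_conj => He'.
by ring: He'.
Qed.

(* omega1^2 - theta1 / 4 = - theta1 (nu / 4)^2. *)
Definition nu e := 2 + 5 * e - 4 * e ^+ 2 - 5 * e ^+ 3 + e ^+ 4 + e ^+ 5 : F.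

Lemma omega_eps_norm : 7 * omega_eps e ^+ 2 - 4 * disc_eps e = - (disc_eps e * nu e ^+ 2).
Proof. by move: He; rewrite /eps_root /omega_eps /disc_eps /nu => He'; ring: He'. Qed.

(** [nu e] is a unit of Z[e], with the displayed inverse. *)
Lemma nu_neq0 : nu e != 0.
Proof.
have E : nu e * (- 3 + 4 * e + 5 * e ^+ 2 - 5 * e ^+ 3 - e ^+ 4 + e ^+ 5) = 1.
  by move: He; rewrite /eps_root /nu => He'; ring: He'.
by apply: contra_eq_neq E => ->; rewrite mul0r eq_sym oner_neq0.
Qed.

Definition rho e := - 49 + 35 * e ^+ 2 - 6 * e ^+ 4 : F.

(** The norm of the radicand [theta1] to Q(e^2), up to a constant: minus a square of [e] times an
    element of Q(e^2). *)
Lemma disc_eps_norm : disc_eps e * disc_eps (- e) = - (e * rho e) ^+ 2.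
Proof. by move: He; rewrite /eps_root /disc_eps /rho => He'; ring: He'. Qed.

Lemma rho_neq0 : (7 : F) != 0 -> rho e != 0.
Proof.
have E : rho e * (- 14 + 22 * e ^+ 2 - 5 * e ^+ 4) = 7.
  by move: He; rewrite /eps_root /rho => He'; ring: He'.
by apply: contraNneq => E0; rewrite -E E0 mul0r.
Qed.

End NormIdentities.

Lemma sqr_eq_opp (F : fieldType) (i a b : F) :
  i ^+ 2 = -1 -> a ^+ 2 = - b ^+ 2 -> a = i * b \/ a = - (i * b).
Proof.
move=> Hi E; have /eqP : a ^+ 2 = (i * b) ^+ 2 by rewrite exprMn Hi mulN1r.
by rewrite eqf_sqr => /orP[] /eqP; [left|right].
Qed.

(** * From the points over one factor to those over the next *)

Section CMStep.
Variable F : fieldType.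
Hypotheses (n2 : (2 : F) != 0) (n7 : (7 : F) != 0).

Let n4 : (4 : F) != 0. Proof. by rewrite (_ : 4 = 2 * 2) ?mulf_neq0 //; ring. Qed.
Let n8 : (8 : F) != 0. Proof. by rewrite (_ : 8 = 2 * 4) ?mulf_neq0 //; ring. Qed.
Let n16 : (16 : F) != 0. Proof. by rewrite (_ : 16 = 2 * 8) ?mulf_neq0 //; ring. Qed.

Lemma mul7_eq (a b : F) : 7 * (a - b) = 0 -> a = b.
Proof. by move/eqP; rewrite mulf_eq0 (negPf n7) subr_eq0 => /eqP. Qed.

Lemma cm_root_i (e t i : F) : eps_root e -> i ^+ 2 = -1 -> quad e t = 0 ->
  let c := 1 + 2 * i in c * t + 1 != 0 /\
  omega_eps (eps_conj e) + i * disc_ratio e * (t - omega_eps e)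
  = t * ((t + c) / (c * t + 1)) ^+ 4.
Proof.
move=> He Hi Ht c.
have := cm_a_spec t He Hi; have := cm_b_spec t He Hi.
have := cm_c_spec t He Hi; have := cm_c_mul t He Hi.
rewrite Ht !mulr0 => /mul7_eq <- /mul7_eq H3 /mul7_eq H2 /mul7_eq; rewrite -/c => H1.
(* If [c t + 1] vanished, so would [t + c]; then [c^2 = 1], that is [4 (1 - i) = 0], and [i = 1]. *)
have nct : c * t + 1 != 0.
  apply/negP => /eqP E0; move: H1; rewrite E0 mulr0 => /eqP.
  rewrite eq_sym mulf_eq0 (negPf n8) /= addrC addr_eq0 => /eqP Ec.
  have E4 : 4 * (1 - i) = 0.
    transitivity (1 - c ^+ 2); first by rewrite /c; ring: Hi.
    by rewrite expr2 {1}Ec -[RHS]E0 ; ring.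
  move: E4 => /eqP; rewrite mulf_eq0 (negPf n4) subr_eq0 /= => /eqP i1.
  move/eqP: Hi; rewrite -i1 expr1n -subr_eq0 opprK (_ : 1 + 1 = 2) //.
  by rewrite (negPf n2).
split=> //; congr (_ * _); set u := (t + c) / (c * t + 1).
have H1' : cm_a0 e i + cm_a1 e i * t = 8 * u.
  by apply: (mulIf nct); rewrite H1 /u; field.
have H2' : cm_b0 e i + cm_b1 e i * t = 4 * u ^+ 2.
  by apply: (mulfI n16); rewrite -H2 H1'; ring.
by apply: (mulfI n16); rewrite -H3 H2'; ring.
Qed.

Lemma cm_root (e t T i : F) : eps_root e -> i ^+ 2 = -1 ->
  quad e t = 0 -> quad (eps_conj e) T = 0 ->
  exists2 j, j = i \/ j = - i & let c := 1 + 2 * j in c * t + 1 != 0 /\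
  T = t * ((t + c) / (c * t + 1)) ^+ 4.
Proof.
move=> He Hi Ht HT.
(* The roots of the next factor differ by a sign of [i]: they come from 2 + i and 2 - i
   respectively. *)
have E : (T - omega_eps (eps_conj e)) ^+ 2 = - (disc_ratio e * (t - omega_eps e)) ^+ 2.
  apply: mul7_eq.
  transitivity (quad (eps_conj e) T + disc_ratio e ^+ 2 * quad e t).
    by rewrite /quad (disc_eps_conj He); ring.
  by rewrite Ht HT mulr0 addr0.
have [E'|E'] := sqr_eq_opp Hi E.
  exists i; first by left.
  have [nc E2] := cm_root_i He Hi Ht; split=> //.
  by rewrite -E2 -mulrA -E'; ring.
have Hi' : (- i) ^+ 2 = -1 by rewrite sqrrN.
exists (- i); first by right.
have [nc E2] := cm_root_i He Hi' Ht; split=> //.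
by rewrite -E2 -mulrA mulNr -E'; ring.
Qed.

Section Field.
Variables (K : fieldType) (iota : {rmorphism K -> F}) (S : F -> Prop).
Local Notation G := (adjoin iota S).

Lemma cm_point (b e t x y T X Y i : F) : eps_root e -> i ^+ 2 = -1 ->
  quad e t = 0 -> x ^+ 2 = b * t -> y ^+ 2 = x ^+ 3 + b * x ->
  quad (eps_conj e) T = 0 -> X ^+ 2 = b * T -> Y ^+ 2 = X ^+ 3 + b * X ->
  b != 0 -> G i -> G b -> G x -> G y -> G X /\ G Y.
Proof.
move=> He Hi Ht Hx Hy HT HX HY nb Gi Gb Gx Gy.
have Gt : G t.
  have -> : t = x ^+ 2 / b by rewrite Hx mulrC mulKf.
  by adjoin_tac.
have [j Hj [nc ET]] := cm_root He Hi Ht HT.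
have Hj2 : j ^+ 2 = -1 by case: Hj => ->; rewrite ?sqrrN.
have Gj : G j by case: Hj => ->; adjoin_tac.
set u := _ / _ in ET; have Gu : G u by rewrite /u; adjoin_tac.
(* Chosen so that [T + 1 = (t + 1) h^2]. The points over [T] are then [(x u^2, y u h)] and its
   images under the automorphisms of the curve. *)
pose h := (t ^+ 2 - (2 + 8 * j) * t + 1) / ((1 + 2 * j) * t + 1) ^+ 2.
have Gh : G h by rewrite /h; adjoin_tac.
have ET1 : T + 1 = (t + 1) * h ^+ 2.
  rewrite ET /u /h; field: Hj2; exact: nc.
have EX : X = x * u ^+ 2 \/ X = - (x * u ^+ 2).
  have /eqP : X ^+ 2 = (x * u ^+ 2) ^+ 2 by rewrite HX ET mulrA -Hx; ring.
  by rewrite eqf_sqr => /orP[] /eqP; [left|right].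
have GX : G X by case: EX => ->; adjoin_tac.
split=> //.
have EY : Y ^+ 2 = X * b * (t + 1) * h ^+ 2.
  by rewrite HY exprS HX -[RHS]mulrA -ET1; ring.
have Ey : y ^+ 2 = x * b * (t + 1).
  by rewrite Hy exprS Hx; ring.
have EyM : (y * u * h) ^+ 2 = x * b * (t + 1) * u ^+ 2 * h ^+ 2 by rewrite -Ey; ring.
case: EX => EX.
  have /eqP : Y ^+ 2 = (y * u * h) ^+ 2 by rewrite EY EX EyM; ring.
  by rewrite eqf_sqr => /orP[] /eqP ->; adjoin_tac.
have : Y ^+ 2 = - (y * u * h) ^+ 2 by rewrite EY EX EyM; ring.
by case/(sqr_eq_opp Hi) => ->; adjoin_tac.
Qed.
End Field.
End CMStep.

(** * The division field *)

Lemma closed_sqrt (F : closedFieldType) (a : F) : exists r, r ^+ 2 = a.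
Proof.
have [r Hr] := @solve_monicpoly F 2 (fun j => if j == 0%N then a else 0) isT.
by exists r; rewrite Hr !big_ord_recl big_ord0 /= mulr1 mul0r !addr0.
Qed.

Section DivisionField.
Variables (K : fieldType) (L : closedFieldType) (iota : {rmorphism K -> L}) (b : K).
Hypotheses (n2 : (2 : L) != 0) (n7 : (7 : L) != 0) (b0 : b != 0).
Local Notation K7 := (division_field iota b 0 7).
Local Notation B := (iota b).

Let nB : B != 0. Proof. by rewrite fmorph_eq0. Qed.

Definition point_over (e t x y : L) :=
  [/\ quad e t = 0, x ^+ 2 = B * t & y ^+ 2 = x ^+ 3 + B * x].

Lemma point_over_exists e : exists t x y, point_over e t x y.
Proof.
have [r Hr] := closed_sqrt (4 * disc_eps e / 7).
have [x Hx] := closed_sqrt (B * (r + omega_eps e)).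
have [y Hy] := closed_sqrt (x ^+ 3 + B * x).
exists (r + omega_eps e), x, y; split=> //.
by rewrite /quad addrK Hr; field.
Qed.

Lemma torsion_mem x y :
  y ^+ 2 = x ^+ 3 + B * x -> psi7 (x ^+ 2 / B) = 0 -> K7 x /\ K7 y.
Proof.
move=> Hy H0.
have tor : torsion B (iota 0) 7 (Affine x y) by rewrite rmorph0; apply/torsion7E.
by split; apply: adjoin_gen; exists x, y; split=> //; [left|right].
Qed.

Lemma psi7_root_mem t : psi7 t = 0 -> K7 t.
Proof.
move=> H0; have [x Hx] := closed_sqrt (B * t).
have [y Hy] := closed_sqrt (x ^+ 3 + B * x).
have Et : t = x ^+ 2 / B by rewrite Hx mulrC mulKf.
have [Kx _] : K7 x /\ K7 y by apply: torsion_mem; rewrite -?Et.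
have KB : K7 B by apply: adjoin_base.
by rewrite Et; adjoin_tac.
Qed.

Section PointOver.
Variables (i e t x y : L).
Hypotheses (Hi : i ^+ 2 = -1) (He : eps_root e) (Hp : point_over e t x y).

Lemma quad_psi7 T : quad e T = 0 -> psi7 T = 0.
Proof. by move=> H0; apply/eqP; rewrite (psi7_eq0 _ n7 He) H0 eqxx. Qed.

(** [omega_eps e] is half the sum of the two roots of [quad e], which are roots of [psi7]. *)
Lemma omega_eps_mem : K7 (omega_eps e).
Proof.
have [t' [x' [y' [Ht _ _]]]] := point_over_exists e.
have Kt : K7 t' by apply/psi7_root_mem/quad_psi7.
have Kt' : K7 (2 * omega_eps e - t').
  by apply/psi7_root_mem/quad_psi7; rewrite -[RHS]Ht /quad; ring.
have -> : omega_eps e = (t' + (2 * omega_eps e - t')) / 2 by field.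
by adjoin_tac.
Qed.

Lemma point_mem : K7 x /\ K7 y.
Proof.
have [Ht Hx Hy] := Hp; apply: torsion_mem => //.
by rewrite Hx [_ * t]mulrC mulfK //; apply: quad_psi7.
Qed.

Lemma y_neq0 : y != 0.
Proof.
have [Ht Hx Hy] := Hp; have [nt nt1 _ _] := psi7_nondegenerate n2 (quad_psi7 Ht).
rewrite -sqrf_eq0; have nx : x != 0 by rewrite -sqrf_eq0 Hx mulf_neq0.
have -> : y ^+ 2 = x * (B * (t + 1)) by rewrite Hy exprS Hx; ring.
by rewrite !mulf_neq0.
Qed.

(** The automorphism sends the torsion point [(x, y)] to [(-x, i y)], so [i] is a quotient of two
    torsion ordinates. *)
Lemma i_mem : K7 i.
Proof.
have [Ht Hx Hy] := Hp; have [Kx Ky] := point_mem.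
have [_ Kiy] : K7 (- x) /\ K7 (i * y).
  apply: torsion_mem; first by rewrite exprMn Hi Hy; ring.
  by rewrite sqrrN Hx [_ * t]mulrC mulfK //; apply: quad_psi7.
by rewrite -(mulfK y_neq0 i); adjoin_tac.
Qed.

(** One point over [e] gives every point over [eps_conj e], and the six conjugates are reached in
    turn. *)
Lemma torsion_sub (S : L -> Prop) X Y :
  adjoin iota S i -> adjoin iota S x -> adjoin iota S y ->
  torsion B (iota 0) 7 (Affine X Y) -> adjoin iota S X /\ adjoin iota S Y.
Proof.
move=> Si Sx Sy; rewrite rmorph0 => /torsion7E [//|//|HY H0].
have SB : adjoin iota S B by apply: adjoin_base.
pose all_in e' := forall t' x' y', point_over e' t' x' y' ->
  adjoin iota S x' /\ adjoin iota S y'.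
have from e' t' x' y' : eps_root e' -> point_over e' t' x' y' -> adjoin iota S x' ->
    adjoin iota S y' -> all_in (eps_conj e').
  move=> He' [Ht' Hx' Hy'] Sx' Sy' T' X' Y' [HT' HX' HY'].
  exact: (cm_point n2 n7 He' Hi Ht' Hx' Hy' HT' HX' HY').
have next e' : eps_root e' -> all_in e' -> all_in (eps_conj e').
  move=> He' Ha; have [t' [x' [y' Hl]]] := point_over_exists e'.
  by have [Sx' Sy'] := Ha _ _ _ Hl; apply: from Hl _ _.
(* The sixth step returns to [e] itself: among the points over [e], only [(x, y)] was known at the
   start. *)
have A1 : all_in (eps_conj e) by apply: from Hp _ _.
have E1 := eps_root_conj He; have A2 := next _ E1 A1.
have E2 := eps_root_conj E1; have A3 := next _ E2 A2.
have E3 := eps_root_conj E2; have A4 := next _ E3 A3.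
have E4 := eps_root_conj E3; have A5 := next _ E4 A4.
have E5 := eps_root_conj E4; have A6 := next _ E5 A5.
have E0 : eps_conj (eps_conj (eps_conj e)) = - e := eps_conj3 He.
rewrite E0 !eps_conj_opp in A3 A4 A5 A6; rewrite E0 opprK in A6.
have lev e' : quad e' (X ^+ 2 / B) = 0 -> point_over e' (X ^+ 2 / B) X Y.
  by move=> Hq; split=> //; rewrite mulrC divfK.
move/eqP: H0; rewrite (psi7_eq0 _ n7 He).
case/or4P=> [/eqP/lev/A6|/eqP/lev/A1|/eqP/lev/A2|] //.
by case/or3P=> [/eqP/lev/A3|/eqP/lev/A4|/eqP/lev/A5].
Qed.

End PointOver.

Lemma zeta_mem i z t x y : i ^+ 2 + 1 = 0 -> 7.-primitive_root z ->
  point_over (eps i z) t x y -> K7 z.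
Proof.
move=> Hi Hz Hp; have He := eps_rootP Hi Hz; have Hi2 := sqr_i Hi.
have Ki := i_mem Hi2 He Hp.
have n56 : (56 : L) != 0.
  by rewrite (_ : 56 = 2 ^+ 3 * 7) ?mulf_neq0 ?expf_neq0 //; ring.
have Ke : K7 (eps i z).
  have := eps_from_omega He; set e := eps i z in He * => E.
  have E1 := eps_root_conj He; have E2 := eps_root_conj E1.
  have -> : e = (56 * e) / 56 by rewrite mulrC mulKf.
  have [W1 W2] := (omega_eps_mem He, omega_eps_mem (eps_root_opp He)).
  have [W3 W4] := (omega_eps_mem E1, omega_eps_mem (eps_root_opp E1)).
  have [W5 W6] := (omega_eps_mem E2, omega_eps_mem (eps_root_opp E2)).
  by rewrite E; adjoin_tac.
have -> : z = (z + z^-1 - i * eps i z) / 2.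
  by rewrite -(zeta_eps _ Hi) mulrC mulKf.
by rewrite (cos_eps Hi Hz); adjoin_tac.
Qed.

Lemma division_field_eq i z t x y : i ^+ 2 + 1 = 0 -> 7.-primitive_root z ->
  point_over (eps i z) t x y -> forall u, K7 u <-> adjoin_seq iota [:: i; z; x; y] u.
Proof.
move=> Hi Hz Hp u; have He := eps_rootP Hi Hz; have Hi2 := sqr_i Hi.
split; last first.
  apply: adjoin_sub_field => v; rewrite !inE.
  have [Kx Ky] := point_mem He Hp.
  case/or4P => /eqP -> //; [exact: (i_mem Hi2 He Hp)|exact: (zeta_mem Hi Hz Hp)].
apply: adjoin_sub_field => v [X [Y [tor Ev]]].
have mem w : w \in [:: i; z; x; y] -> adjoin_seq iota [:: i; z; x; y] w.
  exact: adjoin_seq_mem.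
have [] := torsion_sub Hi2 He Hp _ _ _ tor (S := fun w => w \in [:: i; z; x; y]).
- by apply: mem; rewrite !inE eqxx.
- by apply: mem; rewrite !inE eqxx !orbT.
- by apply: mem; rewrite !inE eqxx !orbT.
by case: Ev => ->.
Qed.
End DivisionField.

(** * Relations between the conditions *)

Section Conditions.
Variables (K L : fieldType) (iota : {rmorphism K -> L}).
Hypotheses (n2 : (2 : L) != 0) (n7 : (7 : L) != 0).
Variables (b : K) (i z s x y : L).
Hypotheses (b0 : b != 0) (Hi : i ^+ 2 + 1 = 0) (Hz : 7.-primitive_root z).
Hypothesis (Hs : s ^+ 2 = theta1 i z).
Local Notation B := (iota b).
Local Notation adjs := (adjoin_seq iota).
Let e := eps i z.
Let c := z + z^-1.
Let He : eps_root e := eps_rootP Hi Hz.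
Let Hi2 : i ^+ 2 = -1 := sqr_i Hi.
Let nB : B != 0. Proof. by rewrite fmorph_eq0. Qed.
Let n4 : (4 : L) != 0. Proof. by rewrite (_ : 4 = 2 * 2) ?mulf_neq0 //; ring. Qed.
Let n16 : (16 : L) != 0. Proof. by rewrite (_ : 16 = 4 * 4) ?mulf_neq0 //; ring. Qed.
Let ni : i != 0.
Proof. by apply: contra_eq_neq Hi => ->; rewrite expr0n add0r oner_neq0. Qed.

Let HsH : 7 * s ^+ 2 = 16 * disc_eps e. Proof. by rewrite Hs (theta1E Hi Hz n7). Qed.

(** If [s = p + r e] over K(i, c), comparing norms in [7 s^2 = 16 disc_eps e] expresses [e], hence
    [z], over K(i, c). *)
Lemma sqrt_theta1_notin : ~ adjs [:: i; c] z -> ~ adjs [:: i; z] s.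
Proof.
move=> nz Ss.
have Si : adjs [:: i; c] i by apply: adjoin_seq_mem; rewrite inE eqxx.
have Sc : adjs [:: i; c] c by apply: adjoin_seq_mem; rewrite !inE eqxx orbT.
have ne : ~ adjs [:: i; c] e.
  move=> Se; apply: nz; have -> : z = (c - i * e) / 2.
    by rewrite -(zeta_eps _ Hi) mulrC mulKf.
  by adjoin_tac.
have Se2 : adjs [:: i; c] (e ^+ 2) by rewrite (sqr_eps Hi Hz); adjoin_tac.
have {Ss} Ss : adjs ([:: i; c] ++ [:: z]) s.
  apply: adjoin_seq_sub Ss => v; rewrite !inE => Hv.
  by apply: adjoin_seq_mem; rewrite !inE; case/orP: Hv => ->; rewrite ?orbT.
have S1 : adjs [:: i; c] (- 1) by adjoin_tac.
have [a [d [Sa Sd Es]]] := quadratic_span Sc S1 (zeta_quadratic Hz) nz Ss.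
pose p := a + d * c / 2; pose r := - (d * i) / 2.
have Sp : adjs [:: i; c] p by rewrite /p; adjoin_tac.
have Sr : adjs [:: i; c] r by rewrite /r; adjoin_tac.
have {}Es : s = p + r * e.
  rewrite Es /p /r; apply: (mulfI n2).
  transitivity (2 * a + d * (2 * z)); first by ring.
  by rewrite (zeta_eps z Hi) -/e -/c; field.
(* Even and odd parts of [disc_eps]; both have coordinates in K(i, c), where [e^2] lies. *)
pose Ae := 322 - 490 * e ^+ 2 + 147 * (e ^+ 2) ^+ 2.
pose Ao := - 42 + 168 * e ^+ 2 - 62 * (e ^+ 2) ^+ 2.
have [|||Ep Er] := @quadratic_free _ _ iota _ _ ne
  (7 * (p ^+ 2 + r ^+ 2 * e ^+ 2) - 16 * Ae) (14 * p * r - 16 * Ao).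
- by rewrite /Ae; adjoin_tac.
- by rewrite /Ao; adjoin_tac.
- transitivity (7 * s ^+ 2 - 16 * disc_eps e); last by rewrite HsH subrr.
  by rewrite Es /Ae /Ao /disc_eps; ring.
(* Multiplying by the conjugate under [e -> -e] turns the two coordinate equations into this norm
   equation, from which [i] extracts a square root. *)
have EN : (7 * (p ^+ 2 - r ^+ 2 * e ^+ 2)) ^+ 2 = - (16 * (e * rho e)) ^+ 2.
  have -> : - (16 * (e * rho e)) ^+ 2 = (16 * Ae) ^+ 2 - (16 * Ao * e) ^+ 2.
    transitivity (16 ^+ 2 * (disc_eps e * disc_eps (- e))).
      by rewrite disc_eps_norm //; ring.
    by rewrite /disc_eps /Ae /Ao; ring.
  by move/eqP: Ep; move/eqP: Er; rewrite !subr_eq0 => /eqP <- /eqP <-; ring.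
apply: ne; have nr := rho_neq0 He n7.
have Srho : adjs [:: i; c] (rho e).
  rewrite /rho (_ : e ^+ 4 = (e ^+ 2) ^+ 2); last by ring.
  by adjoin_tac.
have SN : adjs [:: i; c] (7 * (p ^+ 2 - r ^+ 2 * e ^+ 2)) by adjoin_tac.
set N := 7 * _ in EN SN.
have [E|E] := sqr_eq_opp Hi2 EN.
  have -> : e = N / (i * 16 * rho e) by rewrite E; field; rewrite nr ni n16.
  by adjoin_tac.
have -> : e = - N / (i * 16 * rho e) by rewrite E; field; rewrite nr ni n16.
by adjoin_tac.
Qed.

Hypothesis (Hx : x ^+ 2 = omega1 i z * B + 2^-1 * B * s).

(** The same norm argument for the conjugation [s -> -s]: by [omega_eps_norm] the norm of the
    radicand of [x] is minus the square of [B s nu / 4], and this would give [s] over K(i, z). *)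
Lemma x1_notin : ~ adjs [:: i; z] s -> ~ adjs [:: i; z; s] x.
Proof.
move=> ns Sx.
have Si : adjs [:: i; z] i by apply: adjoin_seq_mem; rewrite inE eqxx.
have Sz : adjs [:: i; z] z by apply: adjoin_seq_mem; rewrite !inE eqxx orbT.
have Se : adjs [:: i; z] e by rewrite /e /eps; adjoin_tac.
have SB : adjs [:: i; z] B by apply: adjoin_base.
have S2 : adjs [:: i; z] (s ^+ 2).
  have -> : s ^+ 2 = 16 * disc_eps e / 7 by rewrite -HsH mulrC mulKf.
  by rewrite /disc_eps; adjoin_tac.
have SW : adjs [:: i; z] (omega_eps e) by rewrite /omega_eps; adjoin_tac.
have Hs0 : s ^+ 2 = 0 * s + s ^+ 2 by rewrite mul0r add0r.
have [p [r [Sp Sr Ex]]] := quadratic_span (adjoin0 _ _) S2 Hs0 ns Sx.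
have [|||Ep Er] := @quadratic_free _ _ iota _ _ ns
  (p ^+ 2 + r ^+ 2 * s ^+ 2 - omega_eps e * B) (2 * p * r - 2^-1 * B).
- by adjoin_tac.
- by adjoin_tac.
- transitivity (x ^+ 2 - (omega1 i z * B + 2^-1 * B * s)); last by rewrite Hx subrr.
  by rewrite Ex (omega1E Hi Hz) -/e; ring.
have EN : (4 * (p ^+ 2 - r ^+ 2 * s ^+ 2)) ^+ 2 = - (B * s * nu e) ^+ 2.
  apply: (mulfI n7).
  transitivity (16 * B ^+ 2 * (7 * omega_eps e ^+ 2 - 4 * disc_eps e)); last first.
    rewrite omega_eps_norm //.
    transitivity (- (B ^+ 2 * (16 * disc_eps e) * nu e ^+ 2)); first by ring.
    by rewrite -HsH; ring.
  have -> : 16 * B ^+ 2 * (7 * omega_eps e ^+ 2 - 4 * disc_eps e)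
     = 7 * 16 * ((omega_eps e * B) ^+ 2 - (2^-1 * B) ^+ 2 * s ^+ 2).
    transitivity (7 * 16 * (omega_eps e * B) ^+ 2 - 4 * B ^+ 2 * (16 * disc_eps e)).
      by ring.
    by rewrite -HsH; field.
  by move/eqP: Ep; move/eqP: Er; rewrite !subr_eq0 => /eqP <- /eqP <-; ring.
apply: ns; have nn := nu_neq0 He.
have Snu : adjs [:: i; z] (nu e) by rewrite /nu; adjoin_tac.
have SN : adjs [:: i; z] (4 * (p ^+ 2 - r ^+ 2 * s ^+ 2)) by adjoin_tac.
set N := 4 * _ in EN SN.
have [E|E] := sqr_eq_opp Hi2 EN.
  have -> : s = N / (i * B * nu e) by rewrite E; field; rewrite nn ni nB.
  by adjoin_tac.
have -> : s = - N / (i * B * nu e) by rewrite E; field; rewrite nn ni nB.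
by adjoin_tac.
Qed.

Hypothesis (Hy : y ^+ 2 = (omega1 i z + 2^-1 * s + 1) * B * x).

Lemma x1_over : x ^+ 2 = B * (omega_eps e + 2^-1 * s)
  /\ quad e (omega_eps e + 2^-1 * s) = 0.
Proof.
split; first by rewrite Hx (omega1E Hi Hz) -/e; ring.
rewrite /quad addrAC subrr add0r exprMn; apply: (mulfI n4).
transitivity (7 * s ^+ 2 - 16 * disc_eps e); first by field.
by rewrite HsH subrr mulr0.
Qed.

Lemma y_curve : y ^+ 2 = x ^+ 3 + B * x.
Proof.
by have [Ex _] := x1_over; rewrite [x ^+ 3]exprS Ex Hy (omega1E Hi Hz) -/e; ring.
Qed.

(** The radicand of [y] is a multiple of [x], so [y = p + r x] forces [p^2 = - (r x)^2], and [x]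
    would be [p / (i r)] up to sign. *)
Lemma y1_notin : ~ adjs [:: i; z; s] x -> ~ adjs [:: i; z; x] y.
Proof.
move=> nx Sy; have [Ex Hq] := x1_over.
have Si : adjs [:: i; z; s] i by apply: adjoin_seq_mem; rewrite inE eqxx.
have Sz : adjs [:: i; z; s] z by apply: adjoin_seq_mem; rewrite !inE eqxx orbT.
have Ss : adjs [:: i; z; s] s by apply: adjoin_seq_mem; rewrite !inE eqxx !orbT.
have Se : adjs [:: i; z; s] e by rewrite /e /eps; adjoin_tac.
have SB : adjs [:: i; z; s] B by apply: adjoin_base.
set t := omega_eps e + 2^-1 * s in Ex Hq.
have St : adjs [:: i; z; s] t by rewrite /t /omega_eps; adjoin_tac.
have S2 : adjs [:: i; z; s] (x ^+ 2) by rewrite Ex; adjoin_tac.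
have {Sy} Sy : adjs ([:: i; z; s] ++ [:: x]) y.
  apply: adjoin_seq_sub Sy => v; rewrite !inE => Hv.
  by apply: adjoin_seq_mem; rewrite !inE; case/or3P: Hv => ->; rewrite ?orbT.
have Hx0 : x ^+ 2 = 0 * x + x ^+ 2 by rewrite mul0r add0r.
have [p [r [Sp Sr Ey]]] := quadratic_span (adjoin0 _ _) S2 Hx0 nx Sy.
have [|||Ep Er] := @quadratic_free _ _ iota _ _ nx
  (p ^+ 2 + r ^+ 2 * x ^+ 2) (2 * p * r - (t + 1) * B).
- by adjoin_tac.
- by adjoin_tac.
- transitivity (y ^+ 2 - (omega1 i z + 2^-1 * s + 1) * B * x); last by rewrite Hy subrr.
  by rewrite Ey (omega1E Hi Hz) -/e /t; ring.
have [_ nt1 _ _] : [/\ t != 0, t + 1 != 0, psi3 t != 0 & psi4 t != 0].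
  apply: (psi7_nondegenerate n2).
  by apply/eqP; rewrite (psi7_eq0 _ n7 He) Hq eqxx.
(* Otherwise the coefficient [(t + 1) B] of the radicand would vanish. *)
have nr : r != 0.
  apply: contraTneq isT => r0; move/eqP: Er; rewrite r0 mulr0 sub0r oppr_eq0 mulf_eq0.
  by rewrite (negPf nt1) (negPf nB).
have EN : p ^+ 2 = - (r * x) ^+ 2.
  by apply/eqP; rewrite -subr_eq0 opprK exprMn Ep.
apply: nx; have [E|E] := sqr_eq_opp Hi2 EN.
  have -> : x = p / (i * r) by rewrite E; field; rewrite ni nr.
  by adjoin_tac.
have -> : x = - p / (i * r) by rewrite E; field; rewrite ni nr.
by adjoin_tac.
Qed.
End Conditions.

(** * The tower from [K] to [K7] and its degree *)

Theorem theorem2 (K : fieldExtType rat) (Kbar : closedFieldType)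
    (iota : {rmorphism K -> Kbar})
    (Kbar_algebraic : forall z : Kbar, algebraicOver iota z)
    (b : K) (b_neq0 : b != 0)
    (i zeta sqrt_theta1 x1 y1 : Kbar)
    (i_root : i ^+ 2 + 1 = 0)
    (zeta_prim : 7.-primitive_root zeta)
    (sqrt_theta1_def : sqrt_theta1 ^+ 2 = theta1 i zeta)
    (x1_def : x1 ^+ 2
       = omega1 i zeta * iota b + 2^-1 * iota b * sqrt_theta1)
    (y1_def : y1 ^+ 2
       = (omega1 i zeta + 2^-1 * sqrt_theta1 + 1) * iota b * x1) :
  let K7 := division_field iota b 0 7 in
  let A := ~ adjoin_seq iota [::] i in
  let B1 := ~ adjoin_seq iota [:: i] (zeta + zeta^-1) in
  let B2 := ~ adjoin_seq iota [:: i; zeta + zeta^-1] zeta in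
  let C := ~ adjoin_seq iota [:: i; zeta] sqrt_theta1 in
  let D := ~ adjoin_seq iota [:: i; zeta; sqrt_theta1] x1 in
  let E := ~ adjoin_seq iota [:: i; zeta; x1] y1 in
  exists2 d : nat, has_degree iota K7 d &
    degree_table d `[< A >] `[< B1 >] `[< B2 >] `[< C >] `[< D >] `[< E >].
Proof.
move=> K7 A B1 B2 C D E.
have nat_neq0 n : (n.+1%:R : Kbar) != 0.
  rewrite -(rmorph_nat iota) fmorph_eq0 -(rmorph_nat (in_alg K)) fmorph_eq0.
  by rewrite Num.Theory.pnatr_eq0.
have n2 : (2 : Kbar) != 0 := nat_neq0 1%N.
have n7 : (7 : Kbar) != 0 := nat_neq0 6%N.
have BC : B2 -> C by apply: sqrt_theta1_notin.
have CD : C -> D by apply: x1_notin x1_def.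
have DE : D -> E by apply: y1_notin x1_def y1_def.
have [Hx Hq] := x1_over n2 n7 i_root zeta_prim sqrt_theta1_def x1_def.
have Hy := y_curve n2 n7 i_root zeta_prim sqrt_theta1_def x1_def y1_def.
have HK7 := division_field_eq n2 n7 b_neq0 i_root zeta_prim (And3 Hq Hx Hy).
have mem s z : z \in s -> adjoin_seq iota s z by apply: adjoin_seq_mem.
have Hi2 : i ^+ 2 = 0 * i + (- 1) by rewrite (sqr_i i_root) mul0r add0r.
have dA := has_degree_quadratic (adjoin0 _ _) (adjoin_opp (adjoin1 _ _)) Hi2
  (has_degree_base iota).
have dB1 := has_degree_cubic (cos_cubic zeta_prim) dA.
have dB2 : has_degree iota (adjoin_seq iota [:: i; zeta])
    (2 ^ `[< B2 >] * (3 ^ `[< B1 >] * (2 ^ `[< A >] * 1))).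
  (* Once [zeta] is adjoined, [zeta + 1/zeta] is redundant as a generator. *)
  apply: has_degree_ext (has_degree_quadratic _ _ (zeta_quadratic zeta_prim) dB1).
  - move=> u; split; apply: adjoin_seq_sub => z; rewrite !inE.
      have Sz : adjoin_seq iota [:: i; zeta] zeta by apply: mem; rewrite !inE eqxx orbT.
      case/or3P=> /eqP -> //; first by apply: mem; rewrite inE eqxx.
      by apply: adjoin_add => //; apply: adjoin_inv.
    by move=> Hz; apply: mem; rewrite !inE; case/orP: Hz => ->; rewrite ?orbT.
  - by apply: mem; rewrite !inE eqxx orbT.
  - exact: (adjoin_opp (adjoin1 _ _)).
have Si s : adjoin_seq iota [:: i, zeta & s] i by apply: mem; rewrite inE eqxx.
have Sz s : adjoin_seq iota [:: i, zeta & s] zeta by apply: mem; rewrite !inE eqxx orbT.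
have Sb s : adjoin_seq iota s (iota b) by apply: adjoin_base.
have dC : has_degree iota (adjoin_seq iota [:: i; zeta; sqrt_theta1])
    (2 ^ `[< C >] * (2 ^ `[< B2 >] * (3 ^ `[< B1 >] * (2 ^ `[< A >] * 1)))).
  apply: (has_degree_quadratic (p := 0) (r := theta1 i zeta)) dB2.
  - exact: adjoin0.
  - have := (Si [::], Sz [::]); rewrite /theta1 => -[Si0 Sz0]; by adjoin_tac.
  - by rewrite mul0r add0r.
have dD : has_degree iota (adjoin_seq iota [:: i; zeta; x1])
    (2 ^ `[< D >] * (2 ^ `[< C >] * (2 ^ `[< B2 >]
      * (3 ^ `[< B1 >] * (2 ^ `[< A >] * 1))))).
  (* Likewise [sqrt_theta1] is redundant next to [x1]: it is recovered from [x1^2]. *)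
  apply: has_degree_ext (has_degree_quadratic (p := 0) (r := x1 ^+ 2) _ _ _ dC).
  - move=> u; split; apply: adjoin_seq_sub => z; rewrite !inE.
      have [Si0 Sz0] := (Si [:: x1], Sz [:: x1]).
      have Sx : adjoin_seq iota [:: i; zeta; x1] x1.
        by apply: mem; rewrite !inE eqxx !orbT.
      case/or4P=> /eqP -> //.
      have -> : sqrt_theta1 = 2 * (x1 ^+ 2 / iota b - omega1 i zeta).
        by rewrite x1_def; field; rewrite ?n2 ?fmorph_eq0 ?b_neq0.
      by have Sb0 := Sb [:: i; zeta; x1]; rewrite /omega1; adjoin_tac.
    by move=> Hz; apply: mem; rewrite !inE; case/or3P: Hz => ->; rewrite ?orbT.
  - exact: adjoin0.
  - have [Si0 Sz0] := (Si [:: sqrt_theta1], Sz [:: sqrt_theta1]).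
    have Ss : adjoin_seq iota [:: i; zeta; sqrt_theta1] sqrt_theta1.
      by apply: mem; rewrite !inE eqxx !orbT.
    have Sb0 := Sb [:: i; zeta; sqrt_theta1].
    by rewrite x1_def /omega1; adjoin_tac.
  - by rewrite mul0r add0r.
have dE : has_degree iota K7 (2 ^ `[< E >] * (2 ^ `[< D >] * (2 ^ `[< C >]
    * (2 ^ `[< B2 >] * (3 ^ `[< B1 >] * (2 ^ `[< A >] * 1)))))).
  apply: has_degree_ext (has_degree_quadratic (p := 0) (r := y1 ^+ 2) _ _ _ dD).
  - by move=> u; split=> /HK7.
  - exact: adjoin0.
  - have [Si0 Sz0] := (Si [:: x1], Sz [:: x1]).
    have Sx : adjoin_seq iota [:: i; zeta; x1] x1 by apply: mem; rewrite !inE eqxx !orbT.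
    have Sb0 := Sb [:: i; zeta; x1].
    by rewrite Hy; adjoin_tac.
  - by rewrite mul0r add0r.
eexists; first exact: dE.
(* Each truth assignment either satisfies the table by computation of the product of degrees, or
   violates one of B2 -> C, C -> D, D -> E. *)
move: (asboolP A) (asboolP B1) (asboolP B2) (asboolP C) (asboolP D) (asboolP E).
case: `[< A >]; case: `[< B1 >]; case: `[< B2 >] => _ _ [] HB2;
  case: `[< C >] => -[] HC; case: `[< D >] => -[] HD; case: `[< E >] => -[] HE //;
  by exfalso; tauto.
Qed.
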